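(* Let $e\in\mathbb{Z}_{\geq 0}$ and $t_e=\tfrac{(e+1)(e+2)}{2}$. The algebra $T_e$ over $\mathbb{C}(v)$ is semisimple, and a complete, irredundant list of its simple representations (up to isomorphism) is the following. (i) If $e\equiv 0 \bmod 3$: the four one-dimensional representations $M_{0,0,0}$, $M_{[3]_v!,0,0}$, $M_{0,[3]_v!,0}$, $M_{0,0,[3]_v!}$, together with the three-dimensional representations $M_z$, where $z$ runs over one representative of each orbit of nonzero complex numbers $z$ with $(z,\overline{z})\in V_e$ under $z\mapsto\zeta z$; there are $(t_e-1)/3$ such orbits. (ii) If $e\not\equiv 0\bmod 3$: the one-dimensional representation $M_{0,0,0}$, together with the three-dimensional representations $M_z$, where $z$ runs over one representative of each orbit of complex numbers $z$ with $(z,\overline{z})\in V_e$ under $z\mapsto\zeta z$; there are $t_e/3$ such orbits.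
   Context: $\mathbb{N}=\mathbb{Z}_{\geq 0}$, $v$ is a generic parameter, $[s]_v=\frac{v^s-v^{-s}}{v-v^{-1}}$, $[3]_v!=[3]_v[2]_v$, $\zeta=\exp(2\pi \sqrt{-1}/3)$, and $\overline{z}$ is the complex conjugate. Polynomials. For generic $q$ let $L_{m,n}$ ($m,n\in\mathbb{N}$) be the irreducible $U_q(\mathfrak{sl}_3)$-module (type 1) of highest weight $m\omega_1+n\omega_2$, $X=L_{1,0}$, $Y=L_{0,1}$. The classes $[X^{\otimes k}\otimes Y^{\otimes l}]$ form a $\mathbb{Z}$-basis of the Grothendieck ring; define $d^{k,l}_{m,n}\in\mathbb{Z}$ by $[L_{m,n}]=\sum_{k,l}d^{k,l}_{m,n}[X^{\otimes k}\otimes Y^{\otimes l}]$ (a finite sum), and $U_{m,n}(X,Y)=\sum_{k,l}d^{k,l}_{m,n}X^kY^l\in\mathbb{Z}[X,Y]$. Equivalently, $U_{0,0}=1$, $U_{1,0}=X$, $U_{0,1}=Y$, $XU_{m,n}=U_{m+1,n}+U_{m-1,n+1}+U_{m,n-1}$, $YU_{m,n}=U_{m,n+1}+U_{m+1,n-1}+U_{m-1,n}$ (zero for negative indices). Let $V_e=\{(\alpha,\beta)\in\mathbb{C}^2\mid U_{m,n}(\alpha,\beta)=0 \text{ for all } m,n\in\mathbb{N},\ m+n=e+1\}$. The algebras. $T_\infty$ is the associative unital $\mathbb{C}(v)$-algebra generated by $\theta_g,\theta_o,\theta_p$ with relations $\theta_u^2=[3]_v!\,\theta_u$ for $u\in\{g,o,p\}$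 and $\theta_g\theta_o\theta_g=\theta_g\theta_p\theta_g$, $\theta_o\theta_g\theta_o=\theta_o\theta_p\theta_o$, $\theta_p\theta_g\theta_p=\theta_p\theta_o\theta_p$. Let $\rho$ be the cyclic permutation $g\mapsto o\mapsto p\mapsto g$. For $k,l\in\mathbb{N}$ and $u\in\{g,o,p\}$ let $h^{k,l}_u=\theta_{u_{k+l}}\cdots\theta_{u_1}\theta_{u_0}$ with $u_0=u$, $u_{i+1}=\rho(u_i)$ for $k$ values of $i$ and $u_{i+1}=\rho^{-1}(u_i)$ for the remaining $l$ values (the result does not depend on the choice). Let $c^{m,n}_u=\sum_{k,l}[2]_v^{-k-l}d^{k,l}_{m,n}h^{k,l}_u$. Then $T_e=T_\infty/I_e$, where $I_e$ is the two-sided ideal generated by all $c^{m,n}_u$ with $m+n=e+1$, $u\in\{g,o,p\}$. The representations. $M_{a,b,c}$ denotes the one-dimensional representation over $\mathbb{C}(v)$ with $\theta_g\mapsto a$, $\theta_o\mapsto b$, $\theta_p\mapsto c$. For $z\in\mathbb{C}$, $M_z$ is the representation on $\mathbb{C}(v)^3$ with $$\theta_g\mapsto[2]_v\begin{pmatrix}[3]_v&\overline z&z\\ 0&0&0\\ 0&0&0\end{pmatrix},\quad \theta_o\mapsto[2]_v\begin{pmatrix}0&0&0\\ z&[3]_v&\overline z\\ 0&0&0\end{pmatrix},\quad \theta_p\mapsto[2]_v\begin{pmatrix}0&0&0\\ 0&0&0\\ \overline z&z&[3]_v\end{pmatrix}.$$ *)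

(* Defs.v *)
From HB Require Import structures.
From mathcomp Require Import all_boot all_order all_algebra.
From mathcomp Require Import fraction polyXY generic_quotient ring_quotient.
From mathcomp Require Import boolp classical_sets cardinality reals trigo.
From mathcomp Require Import complex ring.
From mathcomp Require Import monalg.

Set Implicit Arguments.
Unset Strict Implicit.
Unset Printing Implicit Defensive.

Import GRing.Theory.

Local Open Scope ring_scope.
Local Open Scope quotient_scope.
Local Open Scope classical_set_scope.

(******************************************************************************)
(* Quotient of an algebra by a two-sided ideal. MathComp's ring_quotient only *)
(* multiplies cosets when the ambient ring is commutative.                    *)
(* Ideals are proper, because algType extends nzRingType.                     *)
(******************************************************************************)

HB.mixin Record isProperTwoSidedIdeal (A : pzRingType) (I : {pred A}) := {
  ideal_mull : forall a x, x \in I -> a * x \in I;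
  ideal_mulr : forall a x, x \in I -> x * a \in I;
  ideal_1 : 1 \notin I
}.

#[short(type="twoSidedIdeal")]
HB.structure Definition TwoSidedIdeal (A : pzRingType) :=
  {I of GRing.ZmodClosed A I & isProperTwoSidedIdeal A I}.

Section AlgebraQuotient.
Variables (K : fieldType) (A : algType K) (I : twoSidedIdeal A).

Definition alg_quot : Type := Quotient.quot I.

HB.instance Definition _ := GRing.Zmodule.on alg_quot.

Definition alg_pi (x : A) : alg_quot := \pi_(Quotient.quot I) x.
Definition alg_repr (x : alg_quot) : A := repr (x : Quotient.quot I).

Lemma alg_reprK : cancel alg_repr alg_pi.
Proof. by move=> x; rewrite /alg_pi /alg_repr reprK. Qed.

Lemma alg_pi_eq x y : alg_pi x = alg_pi y <-> x - y \in I.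
Proof. by rewrite Quotient.idealrBE; split=> [e|/eqP//]; apply/eqP. Qed.

Lemma alg_pi_eq0 x : alg_pi x = 0 <-> x \in I.
Proof.
have -> : 0 = alg_pi 0 by rewrite /alg_pi raddf0.
by rewrite -[in X in _ <-> X](subr0 x); apply: alg_pi_eq.
Qed.

Lemma alg_repr_pi x : alg_repr (alg_pi x) - x \in I.
Proof. by apply/alg_pi_eq; rewrite alg_reprK. Qed.

Lemma alg_pi_is_zmod_morphism : zmod_morphism alg_pi.
Proof. by move=> x y; rewrite /alg_pi raddfB. Qed.

HB.instance Definition _ :=
  GRing.isZmodMorphism.Build A alg_quot alg_pi alg_pi_is_zmod_morphism.

(* Multiplication and scaling are locked so that unification does not unfold  *)
(* nested products in the quotient.                                           *)
Fact alg_quot_key : unit. Proof. exact: tt. Qed.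

Definition alg_quot_one : alg_quot := alg_pi 1.
Definition alg_quot_mul : alg_quot -> alg_quot -> alg_quot :=
  locked_with alg_quot_key (fun x y => alg_pi (alg_repr x * alg_repr y)).
Definition alg_quot_scale : K -> alg_quot -> alg_quot :=
  locked_with alg_quot_key (fun a x => alg_pi (a *: alg_repr x)).

Lemma alg_quot_mulE x y : alg_quot_mul (alg_pi x) (alg_pi y) = alg_pi (x * y).
Proof.
rewrite /alg_quot_mul unlock; apply/alg_pi_eq.
set x' := alg_repr _; set y' := alg_repr _.
have -> : x' * y' - x * y = (x' - x) * y' + x * (y' - y).
  by rewrite mulrBl mulrBr addrA subrK.
by apply: rpredD; [apply: ideal_mulr|apply: ideal_mull]; apply: alg_repr_pi.
Qed.

Lemma alg_quot_scaleE a x : alg_quot_scale a (alg_pi x) = alg_pi (a *: x).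
Proof.
rewrite /alg_quot_scale unlock; apply/alg_pi_eq.
by rewrite -scalerBr -mulr_algl; apply/ideal_mull/alg_repr_pi.
Qed.

Lemma alg_quot_mulA : associative alg_quot_mul.
Proof.
by move=> x y z; rewrite -[x]alg_reprK -[y]alg_reprK -[z]alg_reprK
  !alg_quot_mulE mulrA.
Qed.

Lemma alg_quot_mul1 : left_id alg_quot_one alg_quot_mul.
Proof. by move=> x; rewrite -[x]alg_reprK alg_quot_mulE mul1r. Qed.

Lemma alg_quot_1mul : right_id alg_quot_one alg_quot_mul.
Proof. by move=> x; rewrite -[x]alg_reprK alg_quot_mulE mulr1. Qed.

Lemma alg_quot_mulDl : left_distributive alg_quot_mul +%R.
Proof.
move=> x y z; rewrite -[x]alg_reprK -[y]alg_reprK -[z]alg_reprK.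
by rewrite -raddfD !alg_quot_mulE -raddfD /= mulrDl.
Qed.

Lemma alg_quot_mulDr : right_distributive alg_quot_mul +%R.
Proof.
move=> x y z; rewrite -[x]alg_reprK -[y]alg_reprK -[z]alg_reprK.
by rewrite -raddfD !alg_quot_mulE -raddfD /= mulrDr.
Qed.

Lemma alg_quot_1neq0 : alg_quot_one != 0.
Proof. by apply/eqP => /alg_pi_eq0; apply/negP/ideal_1. Qed.

HB.instance Definition _ := GRing.Zmodule_isNzRing.Build alg_quot
  alg_quot_mulA alg_quot_mul1 alg_quot_1mul alg_quot_mulDl alg_quot_mulDr
  alg_quot_1neq0.

Lemma alg_quot_scaleA a b x :
  alg_quot_scale a (alg_quot_scale b x) = alg_quot_scale (a * b) x.
Proof. by rewrite -[x]alg_reprK !alg_quot_scaleE scalerA. Qed.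

Lemma alg_quot_scale1 : left_id 1 alg_quot_scale.
Proof. by move=> x; rewrite -[x]alg_reprK alg_quot_scaleE scale1r. Qed.

Lemma alg_quot_scaleDr : right_distributive alg_quot_scale +%R.
Proof.
move=> a x y; rewrite -[x]alg_reprK -[y]alg_reprK.
by rewrite -raddfD !alg_quot_scaleE -raddfD /= scalerDr.
Qed.

Lemma alg_quot_scaleDl x : {morph alg_quot_scale^~ x : a b / a + b}.
Proof.
by move=> a b; rewrite -[x]alg_reprK !alg_quot_scaleE -raddfD /= scalerDl.
Qed.

HB.instance Definition _ := GRing.Zmodule_isLmodule.Build K alg_quot
  alg_quot_scaleA alg_quot_scale1 alg_quot_scaleDr alg_quot_scaleDl.

Lemma alg_quot_scaleAl (a : K) (x y : alg_quot) : a *: (x * y) = a *: x * y.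
Proof.
rewrite -[x]alg_reprK -[y]alg_reprK.
rewrite /GRing.scale /GRing.mul /=.
by rewrite !(alg_quot_scaleE, alg_quot_mulE) scalerAl.
Qed.

HB.instance Definition _ :=
  GRing.Lmodule_isLalgebra.Build K alg_quot alg_quot_scaleAl.

Lemma alg_quot_scaleAr (a : K) (x y : alg_quot) : a *: (x * y) = x * (a *: y).
Proof.
rewrite -[x]alg_reprK -[y]alg_reprK.
rewrite /GRing.scale /GRing.mul /=.
by rewrite !(alg_quot_scaleE, alg_quot_mulE) scalerAr.
Qed.

HB.instance Definition _ :=
  GRing.Lalgebra_isAlgebra.Build K alg_quot alg_quot_scaleAr.

Lemma alg_pi_is_monoid_morphism : monoid_morphism alg_pi.
Proof. by split=> // x y; rewrite {2}/GRing.mul /= alg_quot_mulE. Qed.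

HB.instance Definition _ := GRing.isMonoidMorphism.Build A alg_quot alg_pi
  alg_pi_is_monoid_morphism.

Lemma alg_pi_is_scalable : scalable alg_pi.
Proof. by move=> a x; rewrite {2}/GRing.scale /= alg_quot_scaleE. Qed.

HB.instance Definition _ := GRing.isScalable.Build K A alg_quot *:%R alg_pi
  alg_pi_is_scalable.

End AlgebraQuotient.

Section QuotientLift.
Variables (K : fieldType) (A : algType K) (I : twoSidedIdeal A).
Variables (B : pzRingType) (f : {rmorphism A -> B}).
Hypothesis fI : forall x, x \in I -> f x = 0.

Definition alg_quot_lift of (forall x, x \in I -> f x = 0) :=
  fun x : alg_quot I => f (alg_repr x).

Let g := alg_quot_lift fI.

Lemma alg_quot_liftE x : g (alg_pi I x) = f x.
Proof.
by apply/eqP; rewrite -subr_eq0 -raddfB; apply/eqP/fI/alg_repr_pi.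
Qed.

Lemma alg_quot_lift_is_zmod_morphism : zmod_morphism g.
Proof.
move=> x y; rewrite -[x]alg_reprK -[y]alg_reprK.
by rewrite -raddfB !alg_quot_liftE raddfB.
Qed.

Lemma alg_quot_lift_is_monoid_morphism : monoid_morphism g.
Proof.
split=> [|x y]; first by rewrite -(rmorph1 (alg_pi I)) alg_quot_liftE rmorph1.
rewrite -[x]alg_reprK -[y]alg_reprK.
by rewrite -rmorphM !alg_quot_liftE rmorphM.
Qed.

HB.instance Definition _ := GRing.isZmodMorphism.Build _ _
  (alg_quot_lift fI) alg_quot_lift_is_zmod_morphism.
HB.instance Definition _ := GRing.isMonoidMorphism.Build _ _
  (alg_quot_lift fI) alg_quot_lift_is_monoid_morphism.

End QuotientLift.

Arguments alg_quot_lift : simpl never.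

Section GeneratedIdeal.
Variable A : pzRingType.

Definition two_sided_closed (I : {pred A}) : Prop :=
  [/\ zmod_closed I,
      forall a x, x \in I -> a * x \in I &
      forall a x, x \in I -> x * a \in I].

Definition ideal_gen (S : set A) : {pred A} := fun x =>
  `[< forall I : {pred A},
        two_sided_closed I -> (forall s, S s -> s \in I) -> x \in I >].

Lemma ideal_genP (S : set A) x :
  reflect (forall I : {pred A},
    two_sided_closed I -> (forall s, S s -> s \in I) -> x \in I)
  (x \in ideal_gen S).
Proof. exact: asboolP. Qed.

Lemma mem_ideal_gen (S : set A) s : S s -> s \in ideal_gen S.
Proof. by move=> Ss; apply/ideal_genP => I _ /(_ s Ss). Qed.

Lemma ideal_gen_closed S : two_sided_closed (ideal_gen S).
Proof.
split; first split.
- by apply/ideal_genP => I [[]].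
- move=> x y /ideal_genP Sx /ideal_genP Sy; apply/ideal_genP => I cI SI.
  by case: (cI) => -[_ IB] _ _; apply: IB; [apply: Sx | apply: Sy].
- move=> a x /ideal_genP Sx; apply/ideal_genP => I cI SI.
  by case: (cI) => _ IM _; apply/IM/Sx.
- move=> a x /ideal_genP Sx; apply/ideal_genP => I cI SI.
  by case: (cI) => _ _ IM; apply/IM/Sx.
Qed.

Lemma ideal_gen_kernel (B : pzRingType) (f : {rmorphism A -> B}) S x :
  (forall s, S s -> f s = 0) -> x \in ideal_gen S -> f x = 0.
Proof.
move=> fS /ideal_genP/(_ (fun x => `[< f x = 0 >])) fx.
apply/asboolP/fx => [|s /fS fs]; last exact/asboolP.
split=> [|a y /asboolP fy|a y /asboolP fy]; last 2 first.
- by apply/asboolP; rewrite rmorphM /= fy mulr0.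
- by apply/asboolP; rewrite rmorphM /= fy mul0r.
split=> [|y z /asboolP fy /asboolP fz]; first by apply/asboolP/raddf0.
by apply/asboolP; rewrite raddfB /= fy fz subr0.
Qed.

End GeneratedIdeal.

(******************************************************************************)
(* Modules over a K-algebra                                                   *)
(******************************************************************************)

Definition simple_submodule (T : pzRingType) (V : lmodType T) (N : {pred V}) :=
  [/\ submod_closed N,
      exists2 x, x \in N & x != 0 &
      forall W : {pred V}, submod_closed W -> {subset W <= N} ->
        (forall x, x \in W -> x = 0) \/ {subset N <= W}].

Definition simple_module (T : pzRingType) (V : lmodType T) :=
  simple_submodule (fun _ : V => true).

Definition module_iso (T : pzRingType) (V W : lmodType T) :=
  exists f : {linear V -> W}, bijective f.

(* The left regular module is an internal direct sum of finitely many simple  *)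
(* submodules (an infinite direct sum containing 1 is necessarily finite).    *)
Definition semisimple_ring (T : pzRingType) :=
  exists (n : nat) (N : 'I_n -> {pred T^o}),
    (forall i, simple_submodule (N i)) /\
    (forall t : T^o, exists! s : {ffun 'I_n -> T^o},
       (forall i, s i \in N i) /\ t = \sum_i s i).

Section MatrixModule.
Variables (K : fieldType) (T : algType K) (n : nat).
Variable phi : {lrmorphism T -> 'M[K]_n}.

Definition matrix_module of {lrmorphism T -> 'M[K]_n} : Type := 'cV[K]_n.

HB.instance Definition _ := GRing.Zmodule.on (matrix_module phi).

Definition matrix_action (t : T) (x : matrix_module phi) : matrix_module phi :=
  phi t *m (x : 'cV[K]_n).

Lemma matrix_actionA s t x :
  matrix_action s (matrix_action t x) = matrix_action (s * t) x.
Proof. by rewrite /matrix_action mulmxA rmorphM. Qed.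

Lemma matrix_action1 : left_id 1 matrix_action.
Proof. by move=> x; rewrite /matrix_action rmorph1 mul1mx. Qed.

Lemma matrix_actionDr : right_distributive matrix_action +%R.
Proof. by move=> t x y; rewrite /matrix_action mulmxDr. Qed.

Lemma matrix_actionDl x : {morph matrix_action^~ x : s t / s + t}.
Proof. by move=> s t; rewrite /matrix_action raddfD mulmxDl. Qed.

HB.instance Definition _ := GRing.Zmodule_isLmodule.Build T (matrix_module phi)
  matrix_actionA matrix_action1 matrix_actionDr matrix_actionDl.

End MatrixModule.

(******************************************************************************)
(* The polynomials U_{m,n}. In {poly {poly int}} the outer variable is 'X and *)
(* the inner one is 'Y, so that d^{k,l}_{m,n} is ((U m n)`_k)`_l.             *)
(******************************************************************************)

(* Column m = 0: eliminating U_{1,n-1} from the two recursions gives          *)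
(*   U_{0,n+1} = Y U_{0,n} - (X U_{0,n-1} - U_{0,n-2}).                       *)
Fixpoint U0 (n : nat) : {poly {poly int}} :=
  match n with
  | 0 => 1
  | n1.+1 => 'Y * U0 n1 -
      match n1 with
      | 0 => 0
      | n2.+1 => 'X * U0 n2 - match n2 with 0 => 0 | n3.+1 => U0 n3 end
      end
  end.

Fixpoint U (m : nat) : nat -> {poly {poly int}} :=
  match m with
  | 0 => U0
  | m1.+1 => fun n =>
      'X * U m1 n
      - (match m1 with 0 => 0 | m2.+1 => U m2 n.+1 end)
      - (match n with 0 => 0 | n1.+1 => U m1 n1 end)
  end.

(* U_{m-1,n} and U_{m,n-1}, with the convention that U vanishes at negative   *)
(* indices.                                                                   *)
Definition U_predl m n := if m is m1.+1 then U m1 n else 0.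
Definition U_predr m n := if n is n1.+1 then U m n1 else 0.

Lemma U00 : U 0 0 = 1. Proof. by []. Qed.

Lemma U10 : U 1 0 = 'X. Proof. by rewrite /= mulr1 !subr0. Qed.

Lemma U01 : U 0 1 = 'Y. Proof. by rewrite /= mulr1 subr0. Qed.

Lemma US m n : U m.+1 n = 'X * U m n - U_predl m n.+1 - U_predr m n.
Proof. by []. Qed.

Lemma U_recX m n : 'X * U m n = U m.+1 n + U_predl m n.+1 + U_predr m n.
Proof. by rewrite US; ring. Qed.

Lemma U_recY m n : 'Y * U m n = U m n.+1 + U_predr m.+1 n + U_predl m n.
Proof.
have rec0 l : 'Y * U 0 l = U 0 l.+1 + U_predr 1 l.
  case: l => [|l]; first by rewrite /U_predr addr0 /= subr0.
  by rewrite /U_predr US /U_predl /=; case: l => [|l] /=; ring.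
have rec1 l : 'Y * U 1 l = U 1 l.+1 + U_predr 2 l + U 0 l.
  rewrite US /U_predl subr0 mulrBr mulrCA rec0 [U 1 l.+1]US /U_predl /=.
  case: l => [|l]; rewrite /U_predr ?rec0; first by ring.
  rewrite [U 2 l]US /U_predl.
  by case: l => [|l]; rewrite /U_predr; ring.
suff H : (forall l, 'Y * U m l = U m l.+1 + U_predr m.+1 l + U_predl m l) /\
    (forall l, 'Y * U m.+1 l = U m.+1 l.+1 + U_predr m.+2 l + U m l).
  by case: H.
elim: m {n} => [|m [IHm IHm1]]; first by split=> l; rewrite ?rec0 ?addr0.
split=> [|l]; first exact: IHm1.
have -> : 'Y * U m.+2 l =
    'X * ('Y * U m.+1 l) - 'Y * U m l.+1 - 'Y * U_predr m.+1 l.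
  by rewrite [U m.+2 l]US /U_predl; ring.
rewrite IHm1 IHm [U m.+2 l.+1]US /U_predl.
rewrite [U m.+1 l in RHS]US.
case: l => [|l]; rewrite /U_predr ?IHm1 /U_predl.
  by case: (m) => [|k]; ring.
rewrite [U m.+3 l]US /U_predl.
by case: l (m) => [|l] [|k]; rewrite /U_predr; ring.
Qed.

Definition dcoef (k l m n : nat) : int := ((U m n)`_k)`_l.

Section FreeAlgebra.
Variables (K : fieldType) (G : choiceType).

Definition free_alg : Type := {malg K[{fmonom G}]}.

HB.instance Definition _ := GRing.Lalgebra.on free_alg.

Lemma free_alg_scaleAr (a : K) (x y : free_alg) : a *: (x * y) = x * (a *: y).
Proof.
have scaleE (z : {malg K[{fmonom G}]}) : z * malgC a = a *: z.
  rewrite malgM_def malgZ_def fgmulgU.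
  by apply/eq_bigr=> /= k _; rewrite mulm1 mulrC.
by rewrite -!scaleE mulrA.
Qed.

HB.instance Definition _ :=
  GRing.Lalgebra_isAlgebra.Build K free_alg free_alg_scaleAr.

Definition free_gen (u : G) : free_alg := mkmalgU (fmu u) 1.

Definition free_aug (x : free_alg) : K :=
  mcoeff (@mone _) (x : {malg K[{fmonom G}]}).

Lemma free_aug_is_zmod_morphism : zmod_morphism free_aug.
Proof. exact: raddfB (mcoeff (@mone _) : {malg K[{fmonom G}]} -> K). Qed.

Lemma free_aug_is_monoid_morphism : monoid_morphism free_aug.
Proof.
have [M1 MM] := @mcoeff1g_is_multiplicative {fmonom G} K.
by split=> [|x y]; [exact: MM | exact: M1].
Qed.

HB.instance Definition _ := GRing.isZmodMorphism.Build free_alg K free_aug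
  free_aug_is_zmod_morphism.
HB.instance Definition _ := GRing.isMonoidMorphism.Build free_alg K free_aug
  free_aug_is_monoid_morphism.

Lemma free_aug_gen u : free_aug (free_gen u) = 0.
Proof.
rewrite /free_aug /free_gen mcoeffU; case: eqP => // /(congr1 val) /=.
by rewrite fmU fm1.
Qed.

Lemma free_augZ a x : free_aug (a *: x) = a * free_aug x.
Proof. exact: mcoeffZ. Qed.

End FreeAlgebra.

Section TrihedralAlgebra.
Variables (K : fieldType) (v : K).

Definition qint (s : nat) : K :=
  (v ^+ s - v ^- s) / (v - v^-1).
Definition qfact3 : K := qint 3 * qint 2.

(* The colours g, o, p are 0, 1, 2 in 'I_3, so that rho is u |-> u + 1. *)
Definition rho (u : 'I_3) : 'I_3 := u + 1.
Definition rho_inv (u : 'I_3) : 'I_3 := u - 1.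

Local Notation F := (free_alg K 'I_3).
Local Notation X := (@free_gen K 'I_3).

Definition trihedral_rels : set F :=
  [set x | exists u, x = X u * X u - qfact3 *: X u] `|`
  [set x | exists u, x = X u * X (rho u) * X u - X u * X (rho_inv u) * X u].

Definition I_inf : {pred F} := ideal_gen trihedral_rels.

Lemma free_aug_rels x : trihedral_rels x -> free_aug x = 0.
Proof.
have aug3 a b : free_aug (X a * X b * X a) = 0.
  by rewrite rmorphM /= free_aug_gen mulr0.
case=> -[u ->].
  by rewrite raddfB /= rmorphM /= free_augZ free_aug_gen !mulr0 subr0.
rewrite raddfB; apply/eqP; rewrite subr_eq0; apply/eqP.
exact: etrans (aug3 _ _) (esym (aug3 _ _)).
Qed.

Lemma I_inf_aug x : x \in I_inf -> free_aug x = 0.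
Proof. exact/ideal_gen_kernel/free_aug_rels. Qed.

Lemma I_inf_1 : 1 \notin I_inf.
Proof.
by apply/negP => /I_inf_aug; rewrite rmorph1; apply/eqP; rewrite oner_eq0.
Qed.

HB.instance Definition _ := GRing.isZmodClosed.Build F I_inf
  (let: And3 h _ _ := ideal_gen_closed trihedral_rels in h).
HB.instance Definition _ := isProperTwoSidedIdeal.Build F I_inf
  (let: And3 _ h _ := ideal_gen_closed trihedral_rels in h)
  (let: And3 _ _ h := ideal_gen_closed trihedral_rels in h) I_inf_1.

Definition T_inf : algType K := alg_quot I_inf.
Definition theta_inf (u : 'I_3) : T_inf := alg_pi I_inf (X u).

Lemma theta_inf_sqr u : theta_inf u * theta_inf u = qfact3 *: theta_inf u.
Proof.
rewrite -rmorphM -linearZ; apply/alg_pi_eq/mem_ideal_gen.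
by left; exists u.
Qed.

Lemma theta_inf_braid u :
  theta_inf u * theta_inf (rho u) * theta_inf u =
  theta_inf u * theta_inf (rho_inv u) * theta_inf u.
Proof.
rewrite -!rmorphM; apply/alg_pi_eq/mem_ideal_gen.
by right; exists u.
Qed.

(* theta_{u_r} ... theta_{u_1} theta_{u_0}, where u_0 = u and u_{i+1} is      *)
(* rho u_i or rho^{-1} u_i according to the i-th bit of s.                    *)
Fixpoint hword (s : seq bool) (u : 'I_3) : T_inf :=
  if s is b :: s' then hword s' (if b then rho u else rho_inv u) * theta_inf u
  else theta_inf u.

Definition h_inf (k l : nat) (u : 'I_3) : T_inf :=
  hword (nseq k true ++ nseq l false) u.

Lemma hword_head s u : exists x, hword s u = x * theta_inf u.
Proof. by case: s => [|b s]; [exists 1; rewrite mul1r | eexists]. Qed.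

Lemma hword_swap s u :
  hword (true :: false :: s) u = hword (false :: true :: s) u.
Proof.
rewrite /= /rho /rho_inv addrK subrK; have [x ->] := hword_head s u.
by rewrite -!mulrA ![theta_inf _ * (_ * _)]mulrA theta_inf_braid.
Qed.

Lemma hword_choice s u : hword s u = h_inf (count id s) (count negb s) u.
Proof.
elim: s u => [//|[] s IHs] u; first by rewrite /= IHs.
rewrite /= IHs /h_inf /= add0n; set k := count id s; set l := count negb s.
rewrite -[LHS]/(hword (false :: nseq k true ++ nseq l false) u).
elim: k u => [//|k IHk] u.
rewrite -[LHS]/(hword (false :: true :: nseq k true ++ nseq l false) u).
by rewrite -hword_swap [LHS]/= -/(nseq _ _) [RHS]/= -IHk.
Qed.

Definition c_inf (m n : nat) (u : 'I_3) : T_inf :=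
  \sum_(k < size (U m n)) \sum_(l < size (U m n)`_k)
    (qint 2 ^- (k + l) * (dcoef k l m n)%:~R) *: h_inf k l u.

Definition I_gens (e : nat) : set T_inf :=
  [set x | exists m n u, (m + n = e.+1)%N /\ x = c_inf m n u].

Definition I_ideal (e : nat) : {pred T_inf} := ideal_gen (I_gens e).

Local Notation T_inf_aug := (alg_quot_lift I_inf_aug).

Lemma T_inf_aug_theta u : T_inf_aug (theta_inf u) = 0.
Proof. by rewrite alg_quot_liftE; apply: free_aug_gen. Qed.

Lemma T_inf_aug_c m n u : T_inf_aug (c_inf m n u) = 0.
Proof.
rewrite /c_inf raddf_sum big1 // => k _; rewrite raddf_sum big1 // => l _.
rewrite /h_inf; have [x ->] := hword_head (nseq k true ++ nseq l false) u.
by rewrite /= -mulr_algl mulrA rmorphM /= T_inf_aug_theta mulr0.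
Qed.

Lemma I_ideal_1 e : 1 \notin I_ideal e.
Proof.
apply/negP => /(@ideal_gen_kernel T_inf K T_inf_aug) h1.
have /h1 : forall s, I_gens e s -> T_inf_aug s = 0.
  by move=> _ [m [n [u [_ ->]]]]; apply: T_inf_aug_c.
by rewrite rmorph1; apply/eqP; rewrite oner_eq0.
Qed.

HB.instance Definition _ e := GRing.isZmodClosed.Build T_inf (I_ideal e)
  (let: And3 h _ _ := ideal_gen_closed (I_gens e) in h).
HB.instance Definition _ e := isProperTwoSidedIdeal.Build T_inf (I_ideal e)
  (let: And3 _ h _ := ideal_gen_closed (I_gens e) in h)
  (let: And3 _ _ h := ideal_gen_closed (I_gens e) in h) (I_ideal_1 e).

Definition T_alg (e : nat) : algType K := alg_quot (I_ideal e).
Definition theta (e : nat) (u : 'I_3) : T_alg e :=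
  alg_pi (I_ideal e) (theta_inf u).

End TrihedralAlgebra.

Section TrihedralRepresentations.
Variable R : realType.

Local Notation C := R[i].
Local Notation K := {fraction {poly R[i]}}.

Definition Ueval (m n : nat) (a b : C) : C :=
  (map_poly (map_poly intr) (U m n)).[a, b].

Definition V_set (e : nat) : set (C * C) :=
  [set p | forall m n : nat, (m + n = e.+1)%N -> Ueval m n p.1 p.2 = 0].

Definition vpar : K := FracField.tofrac 'X.
Definition cst (z : C) : K := FracField.tofrac z%:P.

(* Names for the representations M_{a,b,c} and M_z. *)
Variant rep_label := Label1 of K & K & K | Label3 of C.

Definition rep_dim (i : rep_label) : nat := if i is Label1 _ _ _ then 1 else 3.

Definition mx3 (rows : seq (seq K)) : 'M[K]_3 :=
  \matrix_(i, j) nth 0 (nth [::] rows i) j.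

Definition rep_mx (i : rep_label) (u : 'I_3) : 'M[K]_(rep_dim i) :=
  match i return 'M[K]_(rep_dim i) with
  | Label1 a b c => (nth 0 [:: a; b; c] u)%:M
  | Label3 z =>
      let x := cst z in let y := cst (conjc z) in let q := qint vpar 3 in
      qint vpar 2 *: mx3 (nth [::]
        [:: [:: [:: q; y; x]; [:: 0; 0; 0]; [:: 0; 0; 0]];
            [:: [:: 0; 0; 0]; [:: x; q; y]; [:: 0; 0; 0]];
            [:: [:: 0; 0; 0]; [:: 0; 0; 0]; [:: y; x; q]]] u)
  end.

(* Such a phi is unique, since the theta vpar e u generate T_alg vpar e. *)
Definition is_rep (e : nat) (i : rep_label)
    (phi : {lrmorphism T_alg vpar e -> 'M[K]_(rep_dim i)}) : Prop :=
  forall u, phi (theta vpar e u) = rep_mx i u.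

Definition complete_irredundant_list (e : nat) (L : set rep_label) : Prop :=
  [/\ forall i, L i ->
        exists2 phi : {lrmorphism T_alg vpar e -> 'M[K]_(rep_dim i)},
          is_rep phi & simple_module (matrix_module phi),
      forall i j (phi : {lrmorphism T_alg vpar e -> 'M[K]_(rep_dim i)})
          (psi : {lrmorphism T_alg vpar e -> 'M[K]_(rep_dim j)}),
        L i -> L j -> is_rep phi -> is_rep psi ->
        module_iso (matrix_module phi) (matrix_module psi) -> i = j &
      forall W : lmodType (T_alg vpar e), simple_module W ->
        exists i (phi : {lrmorphism T_alg vpar e -> 'M[K]_(rep_dim i)}),
          [/\ L i, is_rep phi & module_iso W (matrix_module phi)]].

(* exp(2 pi i / 3) *)
Definition zeta : C := Complex (cos (2 * pi / 3)) (sin (2 * pi / 3)).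

Definition zeta_orbit (z : C) : set C :=
  [set w | exists k : nat, w = zeta ^+ k * z].

Definition orbit_representatives (Z S : set C) : Prop :=
  (forall z, S z -> Z z) /\
  (forall z, Z z -> exists! s, S s /\ zeta_orbit z s).

Definition has_orbits (Z : set C) (n : nat) : Prop :=
  ([set zeta_orbit z | z in Z] #= `I_n)%card.

Definition real_points (e : nat) : set C := [set z | V_set e (z, conjc z)].

Definition nonzero_real_points (e : nat) : set C :=
  [set z | real_points e z /\ z <> 0].

Definition t_num (e : nat) : nat := ((e + 1) * (e + 2)) %/ 2.

End TrihedralRepresentations.

(* Main.v *)
From HB Require Import structures.
Require Import Defs.
From mathcomp Require Import all_boot all_order all_algebra.
From mathcomp Require Import fraction polyXY spectral.
From mathcomp Require Import boolp classical_sets cardinality reals trigo.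
From mathcomp Require Import complex ring lra zify.
From mathcomp Require Import finmap monalg.

Set Implicit Arguments.
Unset Strict Implicit.
Unset Printing Implicit Defensive.

Import Order.TTheory GRing.Theory Num.Theory.

Local Open Scope ring_scope.

(** Write A for multiplication by X on the span of the U_{m,n} with
    m + n <= e, where the terms with m + n = e + 1 are dropped. By the Pieri
    rules A is a 0/1 matrix whose transpose is multiplication by Y, and the
    two commute ([adj_normal]), so A is a normal matrix and is diagonalizable
    by the spectral theorem. If Aw = zw, then A^T w is the conjugate of z times
    w, and the Pieri rules read as recursions force w_{m,n} to be
    U_{m,n}(z, conj z) w_{0,0}, with the values on m + n = e + 1 vanishing.
    Hence the eigenvalues of A are exactly the z with (z, conj z) in V_e,
    they are pairwise distinct, there are t_e of them, and the matrix of values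
    (U_{m,n}(z, conj z)) is invertible ([Ueval_mx_unit]).
    Multiplication by zeta permutes them, freely away from the origin; so the
    origin is one of them exactly when 3 does not divide t_e, that is when
    3 divides e, and the numbers of orbits follow ([real_points0],
    [three_cubes]).

    On the algebra side, all words occurring in c^{m,n}_u start in the same
    colour, so a generator multiplies c^{m,n}_u from the left by a scalar, or
    acts on it as X or Y acts on U_{m,n} ([theta_c_up], [theta_c_down]).
    Two consequences. First, T_e is spanned by 1 and the c^{m,n}_u with
    m + n <= e ([T_alg_span]). Second, M_z sends c^{m,n}_u to
    [2]_v U_{m,n}(z, conj z) times the matrix with row u of
    circ([3]_v, z, conj z) placed in row u + m + 2n and zeros elsewhere
    ([rep3_abstract]); the circulant matrix is invertible because v is
    transcendental ([circ_det_neq0]).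

    An element killed by all listed representations has, for every u, a
    coefficient vector on the c^{m,n}_u whose pairing with the values of the
    U_{m,n} vanishes at every point of V_e: a Fourier transform over the cyclic
    group of order three turns the orbit of z into the three colour components
    seen by M_z. As the matrix of values is invertible, the element is zero
    ([joint_injective]). Conversely, its inverse yields elements of T_e that
    map to a given matrix unit of one listed representation and to zero in all
    others ([orbit_unit], [node_unit], [trivial_unit]). So T_e is a
    product of matrix algebras over C(v), one for each listed representation,
    whence semisimplicity and the classification ([unitE_semisimple],
    [matrix_module_simple], [simple_acts_nontrivially],
    [simple_is_matrix_module]). *)

(** * Algebras with a separating family of matrix representations *)

Section ModuleIso.
Variables (T : pzRingType) (V W : lmodType T) (g : {linear V -> W}).

Lemma module_iso_inv : bijective g -> module_iso W V.
Proof.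
case=> f gK fK.
have f_lin : linear f by move=> a x y; apply: (can_inj gK); rewrite linearP !fK.
pose fL := GRing.isLinear.Build T W V *:%R f f_lin.
pose f' : {linear W -> V} := HB.pack f fL.
by exists f'; exists g.
Qed.

Lemma inj_surj_bijective : injective g -> (forall y, exists x, g x = y) ->
  bijective g.
Proof.
move=> g_inj /choice[f fK]; exists f => // x.
by apply: g_inj; rewrite fK.
Qed.

End ModuleIso.

Section MatrixUnits.
Variables (K : fieldType) (T : algType K) (I : finType) (d : I -> nat).
Variable phi : forall i, {lrmorphism T -> 'M[K]_(d i)}.
Variable E : forall i, 'I_(d i) -> 'I_(d i) -> T.
Arguments E : clear implicits.
Hypothesis phiE : forall i a b, phi i (E i a b) = delta_mx a b.
Hypothesis phiE_neq : forall i j a b, i != j -> phi j (E i a b) = 0.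
Hypothesis phi_inj : forall t, (forall i, phi i t = 0) -> t = 0.

Lemma phi_joint_inj s t : (forall i, phi i s = phi i t) -> s = t.
Proof.
move=> eq_st; apply/eqP; rewrite -subr_eq0; apply/eqP/phi_inj => i.
by rewrite raddfB /= eq_st subrr.
Qed.

(** Left multiplication acts on the b-th column of matrix units as on the
    standard basis of column vectors; all other products of matrix units are
    instances. *)
Lemma mul_unitE i (t : T) a b : t * E i a b = \sum_c phi i t c a *: E i c b.
Proof.
apply: phi_joint_inj => j; rewrite rmorphM raddf_sum /=.
have [<-{j}|neq_ij] := eqVneq i j; last first.
  rewrite phiE_neq // mulr0 big1 // => c _.
  by rewrite linearZ /= phiE_neq // scaler0.
under eq_bigr do rewrite linearZ /= phiE.
apply/matrixP => c' b'; rewrite summxE phiE !mxE (bigD1 a) //=.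
rewrite big1 => [|k /negPf neq_ka]; last by rewrite mxE neq_ka mulr0.
rewrite [RHS](bigD1 c') //= big1 => [|k /negPf neq_kc]; last first.
  by rewrite !mxE eq_sym neq_kc mulr0.
by rewrite !mxE !eqxx.
Qed.

Lemma unitE_mul i a b c : E i a b * E i b c = E i a c.
Proof.
rewrite mul_unitE phiE (bigD1 a) //= mxE !eqxx scale1r big1 ?addr0 // => k.
by rewrite mxE => /negPf ->; rewrite scale0r.
Qed.

Lemma unitE_mul0 i a b b' c : b != b' -> E i a b * E i b' c = 0.
Proof.
move=> neq_b; rewrite mul_unitE phiE big1 // => k _.
by rewrite mxE [b' == b]eq_sym (negPf neq_b) andbF scale0r.
Qed.

Lemma unitE_mul_neq i j a b a' b' : i != j -> E i a b * E j a' b' = 0.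
Proof.
by move=> neq_ij; rewrite mul_unitE big1 // => k _; rewrite phiE_neq // mxE scale0r.
Qed.

Lemma unitE_neq0 i a b : E i a b != 0.
Proof.
apply/eqP => /(congr1 (phi i)); rewrite phiE raddf0 => /matrixP/(_ a b).
by rewrite !mxE !eqxx => /eqP; rewrite oner_eq0.
Qed.

Local Notation idx := {i : I & 'I_(d i)}.
Definition idem (k : idx) : T := E (tag k) (tagged k) (tagged k).

Lemma sum_idem : \sum_k idem k = 1.
Proof.
apply: phi_joint_inj => j; rewrite rmorph1 raddf_sum /=.
rewrite [LHS](_ : _ = \sum_i \sum_(a < d i) phi j (E i a a)); last first.
  by rewrite sig_big_dep.
rewrite (bigD1 j) //= [X in _ + X]big1 => [|i neq_ij]; last first.
  by rewrite big1 // => a _; rewrite phiE_neq.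
rewrite addr0; apply/matrixP => a b; rewrite summxE (bigD1 a) //= phiE.
rewrite big1 => [|k /negPf neq_ka]; last by rewrite phiE mxE eq_sym neq_ka.
by rewrite addr0 !mxE eqxx eq_sym.
Qed.

Lemma idem_orth k l : idem k * idem l = if k == l then idem k else 0.
Proof.
case: k l => [i a] [j b]; rewrite /idem /=; case: eqP => [eq_kl|/eqP].
  have eq_ij : i = j := congr1 tag eq_kl.
  case: j / eq_ij b eq_kl => b /eqP; rewrite eq_Tagged /= => /eqP <-.
  exact: unitE_mul.
have [eq_ij|neq_ij _] := eqVneq i j; last exact: unitE_mul_neq.
by case: j / eq_ij b => b; rewrite eq_Tagged /=; apply: unitE_mul0.
Qed.

(** The left ideal generated by a minimal idempotent, described as the
    elements fixed by right multiplication by it. *)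
Definition column (k : idx) : {pred T^o} := fun x => x * idem k == x :> T.

Lemma columnP k (x : T^o) : reflect ((x : T) * idem k = x) (x \in column k).
Proof. exact: eqP. Qed.

Lemma column_closed k : submod_closed (column k).
Proof.
split=> [|a x y /columnP xk /columnP yk]; apply/columnP; first by rewrite mul0r.
by rewrite mulrDl -mulrA xk yk.
Qed.

(** A nonzero x in the column has a nonzero entry x_{cb}, and then a multiple of
    E_{bc} x is the idempotent generating the column. *)
Lemma column_simple k : simple_submodule (column k).
Proof.
split; first exact: column_closed.
  exists (idem k : T^o); last exact: unitE_neq0.
  by apply/columnP; rewrite idem_orth eqxx.
move=> W [W0 Wlin] subW.
have [W_triv|] := pselect (forall x, x \in W -> x = 0); first by left.
move=> /existsNP[x /not_implyP[xW /eqP x_neq0]]; right.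
have WZ a y : y \in W -> a *: y \in W.
  by move=> yW; rewrite -[_ *: _]addr0; apply: Wlin.
case: k subW => i b subW.
have xe : (x : T) * E i b b = x by exact: (elimT (columnP _ _) (subW _ xW)).
have [c xcb] : exists c, phi i x c b != 0.
  apply: contrapT => x0; move/eqP: x_neq0; apply.
  rewrite -xe mul_unitE big1 // => c _.
  have [->|xcb] := eqVneq (phi i x c b) 0; first by rewrite scale0r.
  by case: x0; exists c.
have eW : (E i b b : T^o) \in W.
  have -> : E i b b = ((phi i x c b)^-1 *: E i b c) *: x :> T^o.
    rewrite [RHS](_ : _ = (phi i x c b)^-1 *: (E i b c * (x : T))); last first.
      by rewrite scalerAl.
    rewrite -[X in _ * X]xe mul_unitE mulr_sumr (bigD1 c) //= big1 => [|c' neq_c]; last first.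
      by rewrite -scalerAr unitE_mul0 1?eq_sym // scaler0.
    by rewrite addr0 -scalerAr unitE_mul scalerA mulVf // scale1r.
  exact: WZ.
move=> y /columnP <-; exact: (WZ y _ eW).
Qed.

(** The regular module is the direct sum of the columns, as the idempotents are
    orthogonal with sum one. *)
Lemma unitE_semisimple : semisimple_ring T.
Proof.
exists #|{: idx}|, (fun k => column (enum_val k)); split=> [k|t].
  exact: column_simple.
exists [ffun k => (t : T) * idem (enum_val k) : T^o]; split.
  split=> [k|].
    by apply/columnP; rewrite ffunE -mulrA idem_orth eqxx.
  rewrite -[LHS]mulr1 -sum_idem mulr_sumr (reindex _ (onW_bij _ (enum_val_bij idx))).
  by apply: eq_bigr => k _; rewrite ffunE.
move=> s [sN ->]; apply/ffunP => k; rewrite ffunE mulr_suml (bigD1 k) //=.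
rewrite big1 => [|l neq_lk]; first by rewrite addr0; apply/columnP.
have /columnP <- := sN l; rewrite -mulrA idem_orth.
by rewrite (inj_eq enum_val_inj) (negPf neq_lk) mulr0.
Qed.

Section Simple.
Variables (i : I) (psi : {lrmorphism T -> 'M[K]_(d i)}).
Hypothesis psiE : psi =1 phi i.
Hypothesis d_gt0 : (0 < d i)%N.

Lemma matrix_module_simple : simple_module (matrix_module psi).
Proof.
split=> // [|W [W0 Wlin] _].
  exists (const_mx 1 : 'cV[K]_(d i)) => //; apply/eqP => /colP/(_ (Ordinal d_gt0)).
  by rewrite !mxE => /eqP; rewrite oner_eq0.
have [W_triv|] := pselect (forall x, x \in W -> x = 0); first by left.
move=> /existsNP[x /not_implyP[xW /eqP x_neq0]]; right=> y _.
have [b xb] : exists b, (x : 'cV[K]_(d i)) b 0 != 0 by apply/cV0Pn.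
pose t := \sum_a ((y : 'cV[K]_(d i)) a 0 / (x : 'cV[K]_(d i)) b 0) *: E i a b.
have tE a k : phi i t a k = (y : 'cV[K]_(d i)) a 0 / (x : 'cV[K]_(d i)) b 0 *+ (k == b).
  rewrite /t raddf_sum summxE (bigD1 a) //= big1 => [|c /negPf neq_c].
    by rewrite linearZ /= phiE !mxE eqxx addr0 mulr_natr.
  by rewrite linearZ /= phiE !mxE eq_sym neq_c mulr0.
have -> : y = t *: x.
  rewrite [RHS]/(psi t *m (x : 'cV[K]_(d i))) psiE; apply/colP => a.
  rewrite mxE (bigD1 b) // big1 => [|k /negPf neq_k].
    by rewrite tE eqxx mulr1n /= addr0 divfK.
  by rewrite tE neq_k mul0r.
by rewrite -[_ *: _]addr0; apply: Wlin.
Qed.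

(** When E_{bb} w is nonzero, sending the a-th basis vector to E_{ab} w defines
    a morphism from the column module, which is injective because E_{ba}
    recovers the a-th coordinate, and surjective because W is simple. *)
Lemma simple_is_matrix_module (W : lmodType T) (b : 'I_(d i)) (w : W) :
  simple_module W -> E i b b *: w != 0 -> module_iso W (matrix_module psi).
Proof.
move=> [_ _ W_simple] Ew.
pose el (x : 'cV[K]_(d i)) := \sum_a x a 0 *: E i a b.
pose g (x : matrix_module psi) : W := el x *: w.
have g_lin : linear g.
  move=> t x y; rewrite /g scalerA -scalerDl; congr (_ *: _).
  rewrite /el mulr_sumr.
  under [X in _ = X + _]eq_bigr do rewrite -scalerAr mul_unitE scaler_sumr.
  rewrite exchange_big -big_split /=; apply: eq_bigr => a _.
  rewrite [(t *: x + y) a 0](_ : _ = (psi t *m (x : 'cV[K]_(d i))) a 0 +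
     (y : 'cV[K]_(d i)) a 0); last by rewrite mxE.
  rewrite psiE scalerDl mxE scaler_suml; congr (_ + _).
  by apply: eq_bigr => c _; rewrite scalerA mulrC.
pose gL := GRing.isLinear.Build T _ W *:%R g g_lin.
pose g' : {linear matrix_module psi -> W} := HB.pack g gL.
have g_delta (x : 'cV[K]_(d i)) a : E i b a *: g x = x a 0 *: E i b b *: w.
  rewrite /g scalerA; congr (_ *: _); rewrite /el mulr_sumr (bigD1 a) //=.
  rewrite -scalerAr unitE_mul big1 ?addr0 // => c neq_c.
  by rewrite -scalerAr unitE_mul0 1?eq_sym // scaler0.
apply: (@module_iso_inv _ _ _ g'); apply: inj_surj_bijective.
  apply: raddf_inj => x gx0; apply/colP => a; rewrite [RHS]mxE.
  apply/eqP; apply: contraNT Ew => xa.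
  have := g_delta x a; rewrite [g x]gx0 scaler0 => /esym.
  move/(congr1 (GRing.scale ((x : 'cV[K]_(d i)) a 0)^-1%:A)).
  by rewrite scaler0 scalerA mulr_algl scalerA mulVf // scale1r => ->.
pose img : {pred W} := fun y => `[< exists x, g x = y >].
have [||y0|img_all] := W_simple img.
- split=> [|t y z /asboolP[x <-] /asboolP[x' <-]]; apply/asboolP.
    by exists 0; apply: (raddf0 g').
  by exists (t *: x + x'); apply: g_lin.
- by [].
- pose x : 'cV[K]_(d i) := delta_mx b 0.
  have gx0 : g x = 0 by apply: y0; apply/asboolP; exists x.
  have := g_delta x b.
  by rewrite gx0 scaler0 mxE !eqxx scale1r => /esym/eqP; rewrite (negPf Ew).
- by move=> y; apply/asboolP/img_all.
Qed.

End Simple.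

(** Since the idempotents sum to one, they cannot all annihilate W. *)
Lemma simple_acts_nontrivially (W : lmodType T) : simple_module W ->
  exists i (b : 'I_(d i)) (w : W), E i b b *: w != 0.
Proof.
case=> _ [w _ w_neq0] _; have [k Ek] : exists k, idem k *: w != 0.
  apply: contrapT => E0; move/eqP: w_neq0; apply.
  rewrite -[w]scale1r -sum_idem scaler_suml big1 // => k _.
  by apply/eqP/negPn/negP => Ek; apply: E0; exists k.
by exists (tag k), (tagged k), w.
Qed.

(** The idempotent E_{bb} of the i-th block acts as zero on every other block. *)
Lemma matrix_module_iso_inj i j (psi1 : {lrmorphism T -> 'M[K]_(d i)})
    (psi2 : {lrmorphism T -> 'M[K]_(d j)}) :
  (0 < d i)%N -> psi1 =1 phi i -> psi2 =1 phi j ->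
  module_iso (matrix_module psi1) (matrix_module psi2) -> i = j.
Proof.
move=> d_gt0 psi1E psi2E [f f_bij]; apply/eqP/negPn/negP => neq_ij.
pose b := Ordinal d_gt0; pose x : 'cV[K]_(d i) := delta_mx b 0.
have : f (E i b b *: (x : matrix_module psi1)) = 0.
  by rewrite linearZ /= /GRing.scale /= /matrix_action psi2E phiE_neq // mul0mx.
rewrite -[RHS](raddf0 f) => /(bij_inj f_bij).
rewrite /GRing.scale /= /matrix_action psi1E phiE mul_delta_mx.
by move/colP/(_ b); rewrite !mxE !eqxx => /eqP; rewrite oner_eq0.
Qed.

End MatrixUnits.

(** * The universal property of free algebras *)

Section FreeAlgebraUniversal.
Variables (K : fieldType) (G : choiceType).
Local Notation F := (free_alg K G).

(** The basis of the free algebra given by the words in the generators. *)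
Definition word (s : seq G) : F := mkmalgU (FMonom s) 1.

Lemma word_nil : word [::] = 1.
Proof.
by rewrite /word -fmoneE.
Qed.

Lemma word_cons u s : word (u :: s) = free_gen K u * word s.
Proof.
rewrite /word /free_gen -[in LHS](cat1s u) -fmE.
rewrite malgM_def fgmulUU mulr1; congr mkmalgU.
by apply/eqP; rewrite fmP fmM fmE fmU.
Qed.

Lemma free_alg_span (x : F) :
  exists (S : seq (K * seq G)), x = \sum_(p <- S) p.1 *: word p.2.
Proof.
exists [seq (mcoeff k x, val k) | k <- enum_fset (msupp x)].
rewrite big_map {1}[x]monalgE; apply: eq_bigr => k _ /=.
rewrite /word fmK; apply/malgP => l.
by rewrite mcoeffZ !mcoeffU mulrnAr mulr1.
Qed.

Lemma free_alg_ind (P : F -> Prop) :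
  P 1 -> (forall a x y, P x -> P y -> P (a *: x + y)) ->
  (forall u x, P x -> P (free_gen K u * x)) -> forall x, P x.
Proof.
move=> P1 Plin Pgen x; have [S ->] := free_alg_span x.
have P0 : P 0 by rewrite -(addNr 1) -scaleN1r; apply: Plin.
elim: S => [|[a s] S IH]; first by rewrite big_nil.
rewrite big_cons; apply: Plin IH; elim: s => [|u s IHs]; first by rewrite word_nil.
by rewrite word_cons; apply: Pgen.
Qed.

Section Lift.
Variables (B : algType K) (M : G -> B).

Definition monom_val (m : {fmonom G}) : B := \prod_(u <- (m : seq G)) M u.

Fact monom_val_mmorphism : mmorphism monom_val.
Proof.
split=> [x y|]; first by rewrite /monom_val fmM big_cat.
by rewrite /monom_val fm1 big_nil.
Qed.

HB.instance Definition _ :=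
  monalg.isMultiplicative.Build {fmonom G} B monom_val monom_val_mmorphism.

Definition free_lift : F -> B := mmap (in_alg B) monom_val.

Fact free_lift_is_zmod_morphism : zmod_morphism free_lift.
Proof. exact: mmap_is_additive. Qed.

Fact free_lift_is_monoid_morphism : monoid_morphism free_lift.
Proof.
have comm_alg (g : {malg K[{fmonom G}]}) (m m' : {fmonom G}) :
    GRing.comm (in_alg B (mcoeff m g)) (monom_val m').
  by rewrite /GRing.comm /= mulr_algl mulr_algr.
by have [fM f1] := commr_mmap_is_multiplicative comm_alg; split.
Qed.

Fact free_lift_is_scalable : scalable free_lift.
Proof. by move=> a x; rewrite /free_lift mmapZ mulr_algl. Qed.

HB.instance Definition _ := GRing.isZmodMorphism.Build F B free_lift
  free_lift_is_zmod_morphism.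
HB.instance Definition _ := GRing.isMonoidMorphism.Build F B free_lift
  free_lift_is_monoid_morphism.
HB.instance Definition _ := GRing.isScalable.Build K F B *:%R free_lift
  free_lift_is_scalable.

Lemma free_lift_gen u : free_lift (free_gen K u) = M u.
Proof.
by rewrite /free_lift mmapU /= scale1r mul1r /monom_val fmU big_seq1.
Qed.

End Lift.
End FreeAlgebraUniversal.

(** * Values of the polynomials U *)

(** The two steps mirror the X-recursion for m + 1 and, on the column m = 0, the
    Y-recursion: both involve polynomials of total index at most that of the
    one being multiplied. *)
Lemma U_ind (P : nat -> nat -> Prop) :
  P 0%N 0%N ->
  (forall m n, (forall m' n', (m' + n' <= m + n)%N -> P m' n') -> P m.+1 n) ->
  (forall n, (forall m' n', (m' + n' <= n)%N -> P m' n') -> P 0%N n.+1) ->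
  forall m n, P m n.
Proof.
move=> P00 PX PY m n; have [s] := ubnP (m + n); elim: s m n => // s IHs.
case=> [|m] [|n] // lts; first [apply: PY | apply: PX] => m' n' le_s;
  by apply: IHs; lia.
Qed.

Lemma US_Y n : U 0 n.+1 = 'Y * U 0 n - U_predr 1 n.
Proof. by rewrite U_recY /U_predl addr0 addrK. Qed.

Section Evaluation.
Variable R : realType.
Local Notation C := R[i].

Implicit Types (a b z : C).

Lemma Ueval00 a b : Ueval 0 0 a b = 1.
Proof. by rewrite /Ueval rmorph1 hornerC hornerC. Qed.

Lemma UevalX m n a b :
  Ueval m.+1 n a b = a * Ueval m n a b
    - (if m is m'.+1 then Ueval m' n.+1 a b else 0)
    - (if n is n'.+1 then Ueval m n' a b else 0).
Proof.
rewrite /Ueval US !rmorphB rmorphM /= map_polyX !hornerE.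
by case: m => [|m]; case: n => [|n]; rewrite /U_predl /U_predr ?rmorph0 ?horner0.
Qed.

Lemma UevalY n a b :
  Ueval 0 n.+1 a b = b * Ueval 0 n a b
    - (if n is n'.+1 then Ueval 1 n' a b else 0).
Proof.
rewrite /Ueval US_Y rmorphB rmorphM /= map_polyC /= map_polyX !hornerE.
by case: n => [|n]; rewrite /U_predr ?rmorph0 ?horner0.
Qed.

(** All monomials of U_{m,n} have weights in one coset of the root lattice, on
    which the rotation acts by a fixed scalar. *)
Lemma Ueval_rot (w : C) m n a b : w ^+ 3 = 1 ->
  Ueval m n (w * a) (w ^+ 2 * b) = w ^+ (m + 2 * n) * Ueval m n a b.
Proof.
move=> w3; move: m n; apply: U_ind => [|m n IH|n IH].
- by rewrite !Ueval00 mulr1.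
- rewrite !UevalX IH // !mulrBr; congr (_ - _ - _).
  + by rewrite addSn exprS; ring.
  + case: m IH => [|m] IH; rewrite ?mulr0 // IH; last by lia.
    congr (_ * _); have -> : (m + 2 * n.+1 = m.+2 + 2 * n)%N by lia.
    by congr (_ ^+ _); lia.
  + case: n IH => [|n] IH; rewrite ?mulr0 // IH; last by lia.
    congr (_ * _); have -> : (m.+1 + 2 * n.+1 = 3 + (m + 2 * n))%N by lia.
    by rewrite [in RHS]exprD w3 mul1r.
- rewrite !UevalY IH // mulrBr; congr (_ - _).
  + have -> : (0 + 2 * n.+1 = 2 + (0 + 2 * n))%N by lia.
    by rewrite [in RHS]exprD; ring.
  + case: n IH => [|n] IH; rewrite ?mulr0 // IH; last by lia.
    congr (_ * _); have -> : (0 + 2 * n.+2 = 3 + (1 + 2 * n))%N by lia.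
    by rewrite [in RHS]exprD w3 mul1r.
Qed.

End Evaluation.

(** * Walks in the triangle of weights of level e *)

(** The dominant weights of level at most e. They index a basis of the quotient
    of Z[X,Y] by the U_{m,n} with m + n = e + 1, on which X and Y act by
    truncated multiplication. *)
Definition alcove e : seq (nat * nat) :=
  [seq (m, n) | m <- iota 0 e.+1, n <- iota 0 (e.+1 - m)].

Arguments alcove : simpl never.

Lemma mem_alcove e (p : nat * nat) : (p \in alcove e) = (p.1 + p.2 <= e)%N.
Proof.
case: p => m n; apply/allpairsPdep/idP => [[m' [n' []]]|].
  by rewrite !mem_iota => lt1 lt2 [-> ->]; move: lt1 lt2 => /=; lia.
rewrite [X in X -> _]/= => mn_le; exists m, n; rewrite !mem_iota.
by split=> //; apply/andP; split=> //; rewrite add0n; lia.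
Qed.

Lemma alcove_uniq e : uniq (alcove e).
Proof.
apply: allpairs_uniq_dep => [|m _|[m n] [m' n'] _ _ [-> ->]]//;
  exact: iota_uniq.
Qed.

Lemma size_alcove e : size (alcove e) = t_num e.
Proof.
rewrite size_allpairs_dep.
suff H k : (k <= e.+1)%N -> ( 2 * sumn [seq size (iota 0 (e.+1 - m)) | m <- iota 0 k]
     + k * k = k * (2 * e + 3))%N.
  have := H e.+1 (leqnn _); rewrite /t_num.
  set s := sumn _ => Hs; have -> : ((e + 1) * (e + 2) = s * 2)%N by nia.
  by rewrite mulnK.
elim: k => // k IH ltk; have := IH (ltnW ltk).
rewrite -(addn1 k) iotaD map_cat sumn_cat /= add0n addn0 size_iota; nia.
Qed.

Section WeightTriangle.
Variables (R : realType) (e : nat).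
Local Notation C := R[i].
Local Notation t := (size (alcove e)).

Definition weight (i : 'I_t) : nat * nat := nth (0, 0)%N (alcove e) i.

Lemma weight_in i : ((weight i).1 + (weight i).2 <= e)%N.
Proof. by rewrite -mem_alcove mem_nth. Qed.

Lemma weight_inj : injective weight.
Proof.
by move=> i j /eqP; rewrite nth_uniq ?alcove_uniq // => /eqP/val_inj.
Qed.

Lemma weight_surj m n : (m + n <= e)%N -> exists i, weight i = (m, n).
Proof.
rewrite -(mem_alcove e (m, n)) => mn_in.
have lti : (index (m, n) (alcove e) < t)%N by rewrite index_mem.
by exists (Ordinal lti); rewrite /weight nth_index.
Qed.

Lemma sum_weight (V : zmodType) (F : nat * nat -> V) :
  \sum_i F (weight i) = \sum_(p <- alcove e) F p.
Proof. by rewrite (big_nth (0, 0)%N) big_mkord. Qed.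

(** Tensoring with the vector representation moves p to one of at most three
    neighbours; the value tells whether q is one of them. *)
Definition adj (p q : nat * nat) : nat :=
  (((q.1 == p.1.+1) && (q.2 == p.2)) + ((q.1.+1 == p.1) && (q.2 == p.2.+1))
  + ((q.1 == p.1) && (q.2.+1 == p.2)))%N.

Lemma sum_alcove_pick (V : nmodType) (F : nat * nat -> V) (m n : nat) :
  (\sum_(q <- alcove e) F q *+ ((q.1 == m) && (q.2 == n)))
    = if (m + n <= e)%N then F (m, n) else 0.
Proof.
case: leqP => [mn_in|mn_notin].
  rewrite (bigD1_seq (m, n)) ?alcove_uniq ?mem_alcove //= !eqxx big1 ?addr0 //.
  by case=> a b; rewrite xpair_eqE => /negPf /= ->.
rewrite big1_seq // => -[a b]; rewrite mem_alcove /= => ab_in.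
by case: eqP => //= a_m; case: eqP => //= b_n; lia.
Qed.

Lemma sum_adj (V : nmodType) (F : nat * nat -> V) (m n : nat) :
  (m + n <= e)%N ->
  \sum_(q <- alcove e) F q *+ adj (m, n) q =
    (if (m + n < e)%N then F (m.+1, n) else 0)
    + (if m is m'.+1 then F (m', n.+1) else 0)
    + (if n is n'.+1 then F (m, n') else 0).
Proof.
move=> mn_in; rewrite /adj; under eq_bigr do rewrite !mulrnDr.
rewrite !big_split /= sum_alcove_pick; congr (_ + _ + _).
- case: m mn_in => [|m] mn_in; first by rewrite big1 // => -[].
  under eq_bigr do rewrite eqSS.
  by rewrite sum_alcove_pick addnS -addSn mn_in.
- case: n mn_in => [|n] mn_in; first by rewrite big1 // => q _; rewrite andbF.
  under eq_bigr do rewrite eqSS.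
  by rewrite sum_alcove_pick ifT //; apply: leq_trans mn_in; rewrite addnS.
Qed.

Lemma sum_adjT (V : nmodType) (F : nat * nat -> V) (m n : nat) :
  (m + n <= e)%N ->
  \sum_(q <- alcove e) F q *+ adj q (m, n) =
    (if (m + n < e)%N then F (m, n.+1) else 0)
    + (if n is n'.+1 then F (m.+1, n') else 0)
    + (if m is m'.+1 then F (m', n) else 0).
Proof.
have adjE q : (adj q (m, n) = ((q.1 == m) && (q.2 == n.+1)) +
   ((q.1 == m.+1) && (q.2.+1 == n)) + ((q.1.+1 == m) && (q.2 == n)))%N.
  by case: q => [a b]; rewrite /adj /=; clear; lia.
move=> mn_in; under eq_bigr do rewrite adjE !mulrnDr.
rewrite !big_split /= sum_alcove_pick addnS; congr (_ + _ + _).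
- case: n {adjE} mn_in => [|n] mn_in.
    by rewrite big1 // => q _; rewrite andbF.
  under eq_bigr do rewrite eqSS.
  by rewrite sum_alcove_pick addSn -addnS mn_in.
- case: m {adjE} mn_in => [|m] mn_in; first by rewrite big1 // => -[].
  under eq_bigr do rewrite eqSS.
  by rewrite sum_alcove_pick ifT // ltnW.
Qed.

(** The walks of length two from p to q through a common successor and through
    a common predecessor are equinumerous: exchanging the order of two distinct
    steps matches them off when p and q differ, and a point of the triangle has
    as many successors as predecessors. *)
Lemma adj_normal p q : p \in alcove e -> q \in alcove e ->
  (\sum_(r <- alcove e) adj p r * adj q r = \sum_(r <- alcove e) adj r p * adj r q)%N.
Proof.
have mulnE (a b : nat) : (a * b)%N = b *+ a by rewrite -mulr_natl natn.
under eq_bigr do rewrite mulnE; under [in RHS]eq_bigr do rewrite mulnE.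
case: p q => [m n] [a b]; rewrite !mem_alcove => mn_in ab_in.
rewrite sum_adj // sum_adjT //; move: mn_in ab_in => /= mn_in ab_in.
have oob (x y : nat) : (e < x + y)%N -> (x == a) && (y == b) = false.
  by move=> lt_e; apply/negP => /andP[/eqP xa /eqP yb]; lia.
have neq0S (x : nat) : (0 == x.+1) = false by [].
case: ltnP => mn_lt; case: m n mn_in mn_lt => [|m] [|n] mn_in mn_lt.
all: rewrite /adj /= ?eqSS.
(* Orienting all equations the same way makes corresponding walks
   syntactically equal. *)
all: repeat rewrite [a == _]eq_sym; repeat rewrite [a.+1 == _]eq_sym.
all: repeat rewrite [b == _]eq_sym; repeat rewrite [b.+1 == _]eq_sym.
all: rewrite ?neq0S ?andbF.
5-8: rewrite ?[(_.+3 == a) && _]oob ?[(2 == a) && _]oob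
  ?[_ && (2 == b)]oob ?[_ && (_.+3 == b)]oob; try by lia.
all: repeat match goal with |- context [?x == ?y] =>
  let c := fresh "c" in set c := (x == y); clearbody c end; lia.
Qed.

End WeightTriangle.

(** * The real points of V_e as a spectrum *)

Section Spectrum.
Variables (R : realType) (e : nat).
Local Notation C := R[i].
Local Notation t := (size (alcove e)).

(** A joint eigenvector of the two truncated multiplications is determined by
    its first coordinate, because the recursions defining the U_{m,n} express
    each coordinate through earlier ones. *)
Lemma Ueval_of_rec (a b : C) (w : nat -> nat -> C) :
  (forall m n, (m + n <= e)%N -> a * w m n = w m.+1 n
     + (if m is m'.+1 then w m' n.+1 else 0)
     + (if n is n'.+1 then w m n' else 0)) ->
  (forall n, (n <= e)%N -> b * w 0%N n = w 0%N n.+1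
     + (if n is n'.+1 then w 1%N n' else 0)) ->
  forall m n, (m + n <= e.+1)%N -> w m n = Ueval m n a b * w 0%N 0%N.
Proof.
move=> recX recY; move: (@Ueval00 R) (@UevalX R) (@UevalY R).
move: (@Ueval R) => V V00 VX VY; apply: U_ind => [_|m n IH|n IH le_mn].
- by rewrite V00 mul1r.
- rewrite addSn ltnS => le_mn.
  rewrite VX !mulrBl -mulrA -(IH m n (leqnn _) (leqW le_mn)) recX //.
  case: m IH {recX} le_mn => [|m] IH le_mn; case: n IH le_mn => [|n] IH le_mn.
  + by rewrite !mul0r !addr0 !subr0.
  + by rewrite -(IH 0%N n) ?mul0r ?addr0 ?subr0 ?addrK //; lia.
  + by rewrite -(IH m 1%N) ?mul0r ?addr0 ?subr0 ?addrK //; lia.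
  + rewrite -(IH m n.+2) -?(IH m.+1 n); try lia.
    by rewrite -addrA [X in _ + X]addrC addrA !addrK.
- rewrite VY !mulrBl -mulrA -(IH 0%N n (leqnn _) (leqW le_mn)) recY //.
  case: n IH le_mn => [|n] IH le_mn; first by rewrite mul0r addr0 subr0.
  by rewrite -(IH 1%N n) ?addrK //; lia.
Qed.

(** Truncated multiplication by X; its transpose is truncated multiplication
    by Y. *)
Definition adjmx : 'M[C]_t := \matrix_(i, j) (adj (weight i) (weight j))%:R.

Lemma adjmx_conj : map_mx Num.conj adjmx^T = adjmx^T.
Proof. by apply/matrixP => i j; rewrite !mxE conjC_nat. Qed.

Lemma adjmx_normal : adjmx \is normalmx.
Proof.
apply/normalmxP; rewrite adjmx_conj; apply/matrixP => i j; rewrite !mxE.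
under eq_bigr do rewrite !mxE -natrM.
under [RHS]eq_bigr do rewrite !mxE -natrM.
rewrite (sum_weight _ (fun r => (adj (weight i) r * adj (weight j) r)%:R)).
rewrite (sum_weight _ (fun r => (adj r (weight i) * adj r (weight j))%:R)) -!natr_sum.
by rewrite adj_normal // mem_nth.
Qed.

Local Notation P := (spectralmx adjmx).

Lemma adjmx_spectral :
  adjmx = invmx P *m diag_mx (spectral_diag adjmx) *m P.
Proof. exact/orthomx_spectralP/adjmx_normal. Qed.

Definition eigval (j : 'I_t) : C := spectral_diag adjmx 0 j.

Lemma adjmx_eigen i j :
  \sum_k adjmx i k * invmx P k j = eigval j * invmx P i j.
Proof.
have := congr1 (fun B => (B *m invmx P) i j) adjmx_spectral.
rewrite mulmxK ?spectral_unit // mxE => ->.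
by rewrite mul_mx_diag mxE mulrC.
Qed.

(** For a normal matrix, the adjoint has the same eigenvectors with conjugate
    eigenvalues; here the adjoint is the transpose. *)
Lemma adjmxT_eigen i j :
  \sum_k adjmx k i * invmx P k j = conjc (eigval j) * invmx P i j.
Proof.
have := congr1 (fun B => map_mx Num.conj B^T) adjmx_spectral.
rewrite adjmx_conj !trmx_mul !map_mxM tr_diag_mx map_diag_mx.
rewrite invmx_unitary ?spectral_unitarymx // trmxCK.
rewrite -[map_mx _ P^T]invmx_unitary ?spectral_unitarymx // mulmxA.
move/(congr1 (fun B => (B *m invmx P) i j)); rewrite mulmxK ?spectral_unit //.
rewrite mxE; under eq_bigr do rewrite mxE.
by move=> ->; rewrite mul_mx_diag !mxE mulrC.
Qed.

(** Coordinates of the j-th eigenvector as a function on all pairs of naturals,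
    extended by zero, so that truncation needs no case distinction in the
    recursions. *)
Definition eigvec (j : 'I_t) (m n : nat) : C :=
  \sum_i invmx P i j *+ (weight i == (m, n)).

Lemma eigvec_weight i j : eigvec j (weight i).1 (weight i).2 = invmx P i j.
Proof.
rewrite /eigvec (bigD1 i) //= -surjective_pairing eqxx big1 ?addr0 // => k.
by move/negPf; rewrite (inj_eq (@weight_inj e)) => ->.
Qed.

Lemma eigvec_out j m n : (e < m + n)%N -> eigvec j m n = 0.
Proof.
move=> lt_e; rewrite /eigvec big1 // => i _; case: eqP => // pti.
by have := weight_in i; rewrite pti /= leqNgt lt_e.
Qed.

Lemma eigvec_recX j m n : (m + n <= e)%N ->
  eigval j * eigvec j m n = eigvec j m.+1 n
     + (if m is m'.+1 then eigvec j m' n.+1 else 0)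
     + (if n is n'.+1 then eigvec j m n' else 0).
Proof.
move=> mn_in; have [i pti] := weight_surj mn_in.
have := eigvec_weight i j; have := adjmx_eigen i j; rewrite pti /= => + eij.
rewrite -eij => <-.
under eq_bigr do rewrite mxE -eigvec_weight mulr_natl.
rewrite (sum_weight _ (fun p => eigvec j p.1 p.2 *+ adj (weight i) p)) pti.
rewrite (sum_adj (fun p => eigvec j p.1 p.2)) //.
by case: ltnP => // le_e; rewrite [eigvec j m.+1 n]eigvec_out.
Qed.

Lemma eigvec_recY j m n : (m + n <= e)%N ->
  conjc (eigval j) * eigvec j m n = eigvec j m n.+1
     + (if n is n'.+1 then eigvec j m.+1 n' else 0)
     + (if m is m'.+1 then eigvec j m' n else 0).
Proof.
move=> mn_in; have [i pti] := weight_surj mn_in.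
have := eigvec_weight i j; have := adjmxT_eigen i j; rewrite pti /= => + eij.
rewrite -eij => <-.
under eq_bigr do rewrite mxE -eigvec_weight mulr_natl.
rewrite (sum_weight _ (fun p => eigvec j p.1 p.2 *+ adj p (weight i))) pti.
rewrite (sum_adjT (fun p => eigvec j p.1 p.2)) //.
by case: ltnP => // le_e; rewrite [eigvec j m n.+1]eigvec_out ?addnS.
Qed.

Lemma eigvecE j m n : (m + n <= e.+1)%N ->
  eigvec j m n = Ueval m n (eigval j) (conjc (eigval j)) * eigvec j 0 0.
Proof.
apply: (Ueval_of_rec (w := eigvec j)) => [m' n'|n' le_n]; first exact: eigvec_recX.
by rewrite eigvec_recY // addr0.
Qed.

(** Up to the scaling of its columns, this is the matrix of eigenvectors. *)
Definition Ueval_mx : 'M[C]_t :=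
  \matrix_(i, j) Ueval (weight i).1 (weight i).2 (eigval j) (conjc (eigval j)).

Lemma invP_Ueval_mx : invmx P = Ueval_mx *m diag_mx (\row_j eigvec j 0 0).
Proof.
apply/matrixP => i j; rewrite mul_mx_diag !mxE -eigvecE ?eigvec_weight //.
exact: leq_trans (weight_in i) (leqnSn e).
Qed.

Lemma Ueval_mx_unit : Ueval_mx \in unitmx.
Proof.
have : invmx P \in unitmx by rewrite unitmx_inv spectral_unit.
by rewrite invP_Ueval_mx unitmx_mul => /andP[].
Qed.

Lemma eigvec00_neq0 j : eigvec j 0 0 != 0.
Proof.
have : invmx P \in unitmx by rewrite unitmx_inv spectral_unit.
rewrite invP_Ueval_mx unitmx_mul => /andP[_]; rewrite unitmxE det_diag unitfE.
by move/prodf_neq0/(_ j isT); rewrite mxE.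
Qed.

(** Equal eigenvalues would give equal columns in an invertible matrix. *)
Lemma eigval_inj : injective eigval.
Proof.
move=> i j eq_z; apply/eqP/negPn/negP => neq_ij.
have : Ueval_mx^T \in unitmx by rewrite unitmx_tr Ueval_mx_unit.
rewrite unitmxE (@determinant_alternate _ _ _ i j) ?unitr0 // => k.
by rewrite !mxE eq_z.
Qed.

(** For m + n = e + 1 the eigenvector, hence U_{m,n}, vanishes. *)
Lemma eigval_real_point j : real_points e (eigval j).
Proof.
move=> m n mn; apply: (mulIf (eigvec00_neq0 j)); rewrite -eigvecE ?mn //.
by rewrite mul0r eigvec_out // mn.
Qed.

(** At a point of V_e the values of the U_{m,n} satisfy the truncated recursions
    and form an eigenvector, nonzero because U_{0,0} = 1. *)
Lemma real_point_eigval (z : C) : real_points e z -> exists j, z = eigval j.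
Proof.
move=> Vz; pose u : 'cV[C]_t := \col_i Ueval (weight i).1 (weight i).2 z (conjc z).
have Au : adjmx *m u = z *: u.
  apply/colP => i; rewrite !mxE; under eq_bigr do rewrite !mxE mulr_natl.
  pose F p := Ueval p.1 p.2 z (conjc z).
  rewrite (sum_weight _ (fun p => F p *+ adj (weight i) p)).
  have := weight_in i; case: (weight i) => m n /= mn_in; rewrite sum_adj // /F /=.
  have -> : (if (m + n < e)%N then Ueval m.+1 n z (conjc z) else 0)
      = Ueval m.+1 n z (conjc z).
    by case: ltnP => // le_e; rewrite (Vz m.+1 n) // addSn; lia.
  by rewrite UevalX; case: (m) => [|m']; case: (n) => [|n']; ring.
have u_neq0 : u != 0.
  have [i pti] : exists i : 'I_t, weight i = (0, 0)%N by apply: weight_surj.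
  apply/eqP => /colP/(_ i); rewrite !mxE pti /= Ueval00.
  by apply/eqP; rewrite oner_eq0.
have Pu_neq0 : P *m u != 0.
  apply: contraNneq u_neq0 => /(congr1 (mulmx (invmx P))).
  by rewrite mulKmx ?spectral_unit // mulmx0 => ->.
have [j Puj] : exists j, (P *m u) j 0 != 0.
  by apply/cV0Pn.
exists j; apply: (mulIf Puj).
have := congr1 (fun B => (P *m B) j 0) Au.
rewrite [X in P *m (X *m u)]adjmx_spectral !mulmxA.
rewrite mulmxV ?spectral_unit // mul1mx -mulmxA mul_diag_mx mxE.
by rewrite -scalemxAr [in X in _ = X]mxE => <-.
Qed.

End Spectrum.

(** * Orbits under the third roots of unity *)

Section Orbits.
Variables (R : realType).
Local Notation C := R[i].
Local Open Scope classical_set_scope.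

Lemma zeta_cube : zeta R ^+ 3 = 1.
Proof.
have de_moivre (x y : R) :
    Complex (cos x) (sin x) * Complex (cos y) (sin y)
    = Complex (cos (x + y)) (sin (x + y)) :> C.
  by rewrite cosD sinD; apply/eqP; rewrite eq_complex /= !eqxx addrC eqxx.
rewrite !exprS expr0 mulr1 /zeta !de_moivre.
have -> : 2 * pi / 3 + (2 * pi / 3 + 2 * pi / 3) = pi *+ 2 :> R by field.
rewrite cos2pi -[pi *+ 2]add0r (sinD2pi 0) sin0.
by apply/eqP; rewrite eq_complex /= !eqxx.
Qed.

Lemma zeta_neq1 : zeta R != 1.
Proof.
have pi_gt0 := pi_gt0 R.
rewrite eq_complex /= negb_and; apply/orP; right; rewrite gt_eqF //.
by apply: sin_gt0_pi; apply/andP; split; lra.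
Qed.

Lemma zeta2_neq1 : zeta R ^+ 2 != 1.
Proof.
apply: contra_eq_neq zeta_cube => z2; rewrite exprSr z2 mul1r.
exact: zeta_neq1.
Qed.

Lemma zeta_neq0 : zeta R != 0.
Proof.
by apply/eqP => z0; have /eqP := zeta_cube; rewrite z0 expr0n /= eq_sym oner_eq0.
Qed.

Lemma zeta_sum : 1 + zeta R + zeta R ^+ 2 = 0.
Proof.
have : (zeta R - 1) * (1 + zeta R + zeta R ^+ 2) = 0.
  by transitivity (zeta R ^+ 3 - 1); [ring|rewrite zeta_cube subrr].
by move/eqP; rewrite mulf_eq0 subr_eq0 (negPf zeta_neq1) => /eqP.
Qed.

Lemma zeta_conj : conjc (zeta R) = zeta R ^+ 2.
Proof.
apply: (mulIf zeta_neq0); rewrite -exprSr zeta_cube /zeta.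
apply/eqP; rewrite eq_complex /=; apply/andP; split; apply/eqP.
  by rewrite -[RHS](cos2Dsin2 (2 * pi / 3)); ring.
by ring.
Qed.

(** Orbits are the fibres of the cube map, which gives each orbit a name and
    reduces counting orbits to counting cubes. *)
Lemma zeta_orbitP (z w : C) : zeta_orbit z w <-> w ^+ 3 = z ^+ 3.
Proof.
split=> [[k ->]|wz].
  by rewrite exprMn -exprM mulnC exprM zeta_cube expr1n mul1r.
have : (w - z) * ((w - zeta R * z) * (w - zeta R ^+ 2 * z)) = 0.
  transitivity (w ^+ 3 - zeta R ^+ 3 * z ^+ 3
    - (1 + zeta R + zeta R ^+ 2) * (w ^+ 2 * z - zeta R * w * z ^+ 2)).
    by ring.
  by rewrite zeta_cube zeta_sum wz; ring.
move/eqP; rewrite !mulf_eq0 !subr_eq0 => /or3P[]/eqP ->.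
- by exists 0%N; rewrite mul1r.
- by exists 1%N.
- by exists 2%N.
Qed.

Lemma zeta_orbit_cubeE (z w : C) : (w ^+ 3 == z ^+ 3) =
  (w \in [:: z; zeta R * z; zeta R ^+ 2 * z]).
Proof.
rewrite !inE; apply/eqP/idP => [/zeta_orbitP[k ->]|].
  rewrite -(expr_mod k zeta_cube).
  have : (k %% 3 < 3)%N by rewrite ltn_mod.
  by case: (k %% 3)%N => [|[|[|]]] // _; rewrite ?mul1r ?eqxx ?orbT.
case/or3P=> /eqP ->; apply/zeta_orbitP;
  [exists 0%N|exists 1%N|exists 2%N] => //; by rewrite mul1r.
Qed.

Lemma zeta_orbit_uniq (z : C) : z != 0 ->
  uniq [:: z; zeta R * z; zeta R ^+ 2 * z].
Proof.
move=> z_neq0; have neq (a : C) : a != 1 -> z != a * z.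
  by apply: contraNneq => za; apply/eqP/(mulIf z_neq0); rewrite mul1r -za.
rewrite /= !inE negb_or !andbT !neq ?zeta_neq1 ?zeta2_neq1 //= expr2 -mulrA.
by rewrite (inj_eq (mulfI zeta_neq0)) neq ?zeta_neq1.
Qed.

Lemma real_points_zeta e (z : C) : real_points e z -> real_points e (zeta R * z).
Proof.
move=> Vz m n mn; have zc : conjc (zeta R * z) = zeta R ^+ 2 * conjc z.
  by rewrite -zeta_conj; exact: rmorphM.
rewrite /= zc Ueval_rot ?zeta_cube //.
by rewrite Vz // mulr0.
Qed.

Lemma real_points_cube e (z w : C) :
  real_points e z -> w ^+ 3 = z ^+ 3 -> real_points e w.
Proof.
move=> Vz /zeta_orbitP[k ->]; elim: k => [|k IH]; first by rewrite mul1r.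
by rewrite exprS -mulrA; apply: real_points_zeta.
Qed.

(** The fibre of the cube map through z consists of z, zeta z and zeta^2 z, which
    are distinct for z nonzero. *)
Lemma size_cubes (s : seq C) : uniq s -> 0 \notin s ->
  (forall z w, z \in s -> w ^+ 3 = z ^+ 3 -> w \in s) ->
  size s = (3 * size (undup [seq z ^+ 3 | z <- s]))%N.
Proof.
move=> s_uniq s0 s_closed; pose r := [seq z ^+ 3 | z <- s].
rewrite -[LHS](size_map (fun z => z ^+ 3)) -/r.
rewrite -(perm_size (perm_count_undup r)) size_flatten /shape -map_comp.
have -> : [seq (size \o (fun x => nseq (count_mem x r) x)) i | i <- undup r]
    = [seq 3%N | i <- undup r].
  apply/eq_in_map => c; rewrite mem_undup => /mapP[z zs ->] /=.
  rewrite size_nseq count_map -size_filter.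
  rewrite -/(size [:: z; zeta R * z; zeta R ^+ 2 * z]).
  apply/perm_size/uniq_perm; first exact: filter_uniq.
    by apply: zeta_orbit_uniq; apply: contraNneq s0 => <-.
  move=> w; rewrite mem_filter /= zeta_orbit_cubeE.
  case: (boolP (w \in _)) => // /[!(esym (zeta_orbit_cubeE z w))] /eqP wz.
  exact: s_closed wz.
by elim: (undup r) => //= c l ->; rewrite mulnS.
Qed.

Section Count.
Variable e : nat.
Local Notation t := (size (alcove e)).

Definition nonzero_seq : seq C := [seq z <- codom (@eigval R e) | z != 0].

Lemma mem_nonzero_seq z : z \in nonzero_seq <-> nonzero_real_points e z.
Proof.
rewrite mem_filter; split=> [/andP[/eqP z0 /codomP[i zi]]|[Vz /eqP z0]].
  by split=> //; rewrite zi; apply: eigval_real_point.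
by rewrite z0; have [i ->] := real_point_eigval Vz; rewrite codom_f.
Qed.

Lemma size_nonzero_seq :
  size nonzero_seq = if 0 \in codom (@eigval R e) then (t_num e).-1 else t_num e.
Proof.
have cu : uniq (codom (@eigval R e)) by apply/injectiveP/eigval_inj.
rewrite /nonzero_seq -rem_filter //; case: ifP => [c0|/negbT c0].
  by rewrite size_rem // size_codom card_ord size_alcove.
by rewrite rem_id // size_codom card_ord size_alcove.
Qed.

Definition cubes : seq C := undup [seq z ^+ 3 | z <- nonzero_seq].

Lemma size_nonzero_cubes : size nonzero_seq = (3 * size cubes)%N.
Proof.
apply: size_cubes => [||z w /mem_nonzero_seq[Vz z0] wz].
- by apply/filter_uniq/injectiveP/eigval_inj.
- by rewrite mem_filter eqxx.
apply/mem_nonzero_seq; split; first exact: real_points_cube Vz wz.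
by move/eqP: wz => /[swap] ->; rewrite expr0n eq_sym expf_eq0 => /eqP.
Qed.

Lemma alcove_gt0 : (0 < t)%N.
Proof. by rewrite -has_predT; apply/hasP; exists (0, 0)%N; rewrite ?mem_alcove. Qed.

Lemma t_num_mod3 : (t_num e %% 3 = (e %% 3 == 0))%N.
Proof.
have t2 : (2 * t_num e = (e + 1) * (e + 2))%N.
  rewrite /t_num mulnC divnK //; rewrite dvdn2 oddM !oddD /=.
  by case: (odd e).
have e_eq := divn_eq e 3; have lt3 : (e %% 3 < 3)%N by rewrite ltn_mod.
move: (e %/ 3)%N (e %% 3)%N e_eq lt3 => q r -> lt3 in t2 *.
move: (t_num _) t2 => s t2; have s_eq := divn_eq s 3.
have : (s %% 3 < 3)%N by rewrite ltn_mod.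
move: (s %/ 3)%N (s %% 3)%N s_eq => a b s_eq b_lt; rewrite s_eq in t2.
by case: r lt3 t2 => [|[|[|]]] // _; case: b b_lt {s_eq} => [|[|[|]]] // _ /=; nia.
Qed.

(** Since the nonzero points come in threes, the origin occurs exactly when the
    total number of points is not divisible by three. *)
Lemma real_points0 : real_points e (0 : C) <-> (e %% 3 = 0)%N.
Proof.
have t_pos := alcove_gt0; have tm := t_num_mod3; have sz := size_nonzero_cubes.
rewrite size_nonzero_seq in sz; rewrite size_alcove in t_pos.
have c0 : 0 \in codom (@eigval R e) <-> real_points e (0 : C).
  split=> [/codomP[i ->]|/real_point_eigval[i ->]]; [exact: eigval_real_point|exact: codom_f].
split=> [/c0 V0|e0].
  by rewrite V0 in sz; move: tm; case: eqP => //; lia.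
by apply/c0; apply/negPn/negP => /negPf V0; rewrite V0 e0 /= in sz tm; lia.
Qed.

Lemma three_cubes : (3 * size cubes = t_num e - (e %% 3 == 0))%N.
Proof.
rewrite -size_nonzero_cubes size_nonzero_seq; case: eqP => [e0|e0].
  rewrite ifT ?subn1 //.
  by have /real_points0/real_point_eigval[i ->] := e0; rewrite codom_f.
rewrite subn0 ifF //; apply/negP => /codomP[i z0].
by apply: e0; apply/real_points0; rewrite z0; apply: eigval_real_point.
Qed.

Lemma nonzero_has_orbits : has_orbits (@nonzero_real_points R e) (size cubes).
Proof.
rewrite /has_orbits.
have -> : [set zeta_orbit z | z in @nonzero_real_points R e]
    = [set [set w : C | w ^+ 3 = nth 0 cubes i] | i in `I_(size cubes)].
  apply/seteqP; split=> [A [z /mem_nonzero_seq z_in <-]|A [i /= lt_i <-]].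
    have c_in : z ^+ 3 \in cubes by rewrite mem_undup (map_f (fun w : C => w ^+ 3)).
    exists (index (z ^+ 3) cubes); first by rewrite /= index_mem.
    rewrite nth_index //; apply/seteqP.
    by split=> w /=; rewrite zeta_orbitP.
  have := mem_nth 0 lt_i; rewrite mem_undup => /mapP[z z_in ->].
  exists z; first exact/mem_nonzero_seq.
  by apply/seteqP; split=> w /=; rewrite zeta_orbitP.
apply: inj_card_eq => i j /set_mem /= lt_i /set_mem /= lt_j eq_ij.
apply/eqP; rewrite -(nth_uniq 0 lt_i lt_j (undup_uniq _)); apply/eqP.
have := mem_nth 0 lt_i; rewrite mem_undup => /mapP[z z_in zi].
by have : [set w : C | w ^+ 3 = nth 0 cubes i] z by []; rewrite eq_ij => <-.
Qed.

Lemma real_points_nonzero : (e %% 3 <> 0)%N ->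
  @nonzero_real_points R e = @real_points R e.
Proof.
move=> e0; apply/seteqP; split=> [z []//|z Vz]; split=> // z0.
by apply: e0; apply/real_points0; rewrite -z0.
Qed.

Lemma ex_representatives : exists S, @orbit_representatives R (nonzero_real_points e) S.
Proof.
pose rep c : C := nth 0 nonzero_seq (find (fun z => z ^+ 3 == c) nonzero_seq).
have repP z : nonzero_real_points e z ->
    nonzero_real_points e (rep (z ^+ 3)) /\ rep (z ^+ 3) ^+ 3 = z ^+ 3.
  move=> /mem_nonzero_seq z_in.
  have hz : has (fun w => w ^+ 3 == z ^+ 3) nonzero_seq.
    by apply/hasP; exists z.
  by split; [apply/mem_nonzero_seq; rewrite mem_nth -?has_find|
             apply/eqP; apply: (nth_find 0 hz)].
exists [set rep (z ^+ 3) | z in nonzero_real_points e].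
split=> [_ [z Vz <-]|z Vz]; first by have [] := repP z Vz.
exists (rep (z ^+ 3)); split; first split.
- by exists z.
- by apply/zeta_orbitP; have [] := repP z Vz.
move=> _ [[w Vw <-]] /zeta_orbitP.
by have [_ ->] := repP w Vw => ->.
Qed.

End Count.
End Orbits.

(** * Monomials of the polynomials U *)

Section CoefficientSum.
Variable V : zmodType.
Implicit Types (h : nat -> nat -> V) (p q : {poly {poly int}}).

(** The value at p of the additive map sending X^k Y^l to [h k l]. *)
Definition monomial_sum h p : V :=
  \sum_(k < size p) \sum_(l < size p`_k) h k l *~ p`_k`_l.

Lemma sum_ord_widen (F : nat -> V) n N : (n <= N)%N ->
  (forall i, (n <= i)%N -> F i = 0) -> \sum_(i < n) F i = \sum_(i < N) F i.
Proof.
move=> le_nN F0; rewrite -!(big_mkord xpredT) (@big_cat_nat _ _ _ n 0 N) //=.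
by rewrite [X in _ + X]big_nat_cond [X in _ + X]big1 ?addr0 // => i /andP[/andP[/F0]].
Qed.

Lemma monomial_sum_wide h p N M : (size p <= N)%N -> (forall k, (size p`_k)%R <= M)%N ->
  monomial_sum h p = \sum_(k < N) \sum_(l < M) h k l *~ p`_k`_l.
Proof.
move=> leN leM; rewrite /monomial_sum.
rewrite (sum_ord_widen (F := fun k => \sum_(l < size p`_k) h k l *~ p`_k`_l) leN).
  apply: eq_bigr => k _; apply: (sum_ord_widen (F := fun l => h k l *~ p`_k`_l)) => //.
  by move=> l le_l; rewrite [p`_k`_l]nth_default ?mulr0z.
by move=> k le_k; rewrite [p`_k]nth_default // size_poly0 big_ord0.
Qed.

Lemma size_coef_bound p : exists M, forall k, ((size p`_k)%R <= M)%N.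
Proof.
exists (\max_(k < size p) (size p`_k)%R) => k.
have [lt_k|le_k] := ltnP k (size p).
  by rewrite (leq_bigmax (F := fun k : 'I_(size p) => size p`_k) (Ordinal lt_k)).
by rewrite nth_default // size_poly0.
Qed.

Lemma monomial_sumB h p q : monomial_sum h (p - q) = monomial_sum h p - monomial_sum h q.
Proof.
have [M Mp] := size_coef_bound p; have [M' Mq] := size_coef_bound q.
pose N := maxn (size p) (size q); pose L := maxn M M'.
rewrite (@monomial_sum_wide h p N L) ?leq_maxl // => [|k]; last first.
  by rewrite (leq_trans (Mp k)) // leq_maxl.
rewrite (@monomial_sum_wide h q N L) ?leq_maxr // => [|k]; last first.
  by rewrite (leq_trans (Mq k)) // leq_maxr.
rewrite (@monomial_sum_wide h (p - q) N L).
- rewrite -sumrB; apply: eq_bigr => k _; rewrite -sumrB; apply: eq_bigr => l _.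
  by rewrite !coefB mulrzBr.
- by rewrite (leq_trans (size_polyD _ _)) // size_polyN.
move=> k; rewrite coefB (leq_trans (size_polyD _ _)) // size_polyN.
by rewrite geq_max (leq_trans (Mp k)) ?leq_maxl // (leq_trans (Mq k)) ?leq_maxr.
Qed.

Lemma monomial_sum0 h : monomial_sum h 0 = 0.
Proof. by have := monomial_sumB h 0 0; rewrite !subrr. Qed.

Lemma monomial_sumD h p q : monomial_sum h (p + q) = monomial_sum h p + monomial_sum h q.
Proof.
rewrite -{1}[q]opprK monomial_sumB -[- q]sub0r monomial_sumB monomial_sum0.
by rewrite sub0r opprK.
Qed.

Lemma monomial_sumX h p : monomial_sum h ('X * p) = monomial_sum (fun k => h k.+1) p.
Proof.
have [M Mp] := size_coef_bound p.
rewrite (@monomial_sum_wide _ p _ M (leqnn _) Mp).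
rewrite (@monomial_sum_wide _ ('X * p) (size p).+1 M).
- rewrite big_ord_recl big1 ?add0r => [|l _]; last first.
    by rewrite coefXM eqxx coef0 mulr0z.
  by apply: eq_bigr => k _; apply: eq_bigr => l _; rewrite coefXM.
- by rewrite (leq_trans (size_polyMleq _ _)) // size_polyX.
by case=> [|k]; rewrite coefXM ?size_poly0 //= Mp.
Qed.

Lemma monomial_sumY h p : monomial_sum h ('Y * p) = monomial_sum (fun k l => h k l.+1) p.
Proof.
have [M Mp] := size_coef_bound p.
rewrite (@monomial_sum_wide _ p _ M (leqnn _) Mp).
rewrite (@monomial_sum_wide _ ('Y * p) (size p) M.+1).
- apply: eq_bigr => k _; rewrite big_ord_recl coefCM coefXM mulr0z add0r.
  by apply: eq_bigr => l _; rewrite coefXM.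
- rewrite (leq_trans (size_polyMleq _ _)) // size_polyC.
  by rewrite polyX_eq0 add1n.
by move=> k; rewrite coefCM (leq_trans (size_polyMleq _ _)) // size_polyX ltnS.
Qed.

Lemma monomial_sum1 h : monomial_sum h 1 = h 0%N 0%N.
Proof.
by rewrite /monomial_sum size_poly1 big_ord1 coef1 size_poly1 big_ord1 coef1 mulr1z.
Qed.

Lemma eq_monomial_sum h h' p :
  (forall k l, p`_k`_l != 0 -> h k l = h' k l) -> monomial_sum h p = monomial_sum h' p.
Proof.
move=> eq_h; apply: eq_bigr => k _; apply: eq_bigr => l _.
by have [->|/eq_h ->//] := eqVneq p`_k`_l 0; rewrite !mulr0z.
Qed.

End CoefficientSum.

Lemma monomial_sum_morph (V W : zmodType) (f : V -> W) h p :
  {morph f : x y / x - y} ->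
  f (monomial_sum h p) = monomial_sum (fun k l => f (h k l)) p.
Proof.
move=> fB; pose f' : {additive V -> W} :=
  HB.pack f (GRing.isZmodMorphism.Build V W f fB).
rewrite -[f _]/(f' _) raddf_sum; apply: eq_bigr => k _.
by rewrite raddf_sum; apply: eq_bigr => l _; rewrite raddfMz.
Qed.

(** The class of the weight of X^k Y^l modulo the root lattice is k + 2 l
    modulo 3. *)
Definition triality c (p : {poly {poly int}}) :=
  forall k l, p`_k`_l != 0 -> (k + 2 * l = c %[mod 3])%N.

Lemma triality0 c : triality c 0.
Proof. by move=> k l; rewrite !coef0 eqxx. Qed.

Lemma trialityB c p q : triality c p -> triality c q -> triality c (p - q).
Proof.
move=> cp cq k l; rewrite !coefB.
have [->|/cp //] := eqVneq p`_k`_l 0; have [->|/cq //] := eqVneq q`_k`_l 0.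
by rewrite subr0 eqxx.
Qed.

Lemma trialityX c p : triality c p -> triality c.+1 ('X * p).
Proof.
move=> cp [|k] l; rewrite coefXM ?coef0 ?eqxx //= => /cp ckl.
by rewrite -addn1 -[in RHS]addn1 addnAC -modnDml ckl modnDml.
Qed.

Lemma trialityY c p : triality c p -> triality c.+2 ('Y * p).
Proof.
move=> cp k [|l]; rewrite coefCM coefXM ?eqxx //= => /cp ckl.
by rewrite mulnSr addnA -[in RHS]addn2 -modnDml ckl modnDml.
Qed.

Lemma triality_mod c c' p : (c = c' %[mod 3])%N -> triality c p -> triality c' p.
Proof. by move=> cc' cp k l /cp ->. Qed.

(** Multiplication by X and Y shifts the class by 1 and 2, and the three terms of
    each Pieri rule lie in one class. *)
Lemma U_triality m n : triality (m + 2 * n) (U m n).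
Proof.
move: m n; apply: U_ind => [|m n IH|n IH].
- move=> [|k] [|l]; rewrite U00 coef1 ?coef1 ?coef0 ?eqxx //.
- rewrite US; apply: trialityB; first apply: trialityB.
  + exact/trialityX/IH.
  + case: m IH => [|m] IH; first exact: triality0.
    apply: triality_mod (IH m n.+1 _); last by lia.
    by congr modn; lia.
  + case: n IH => [|n] IH; first exact: triality0.
    apply: triality_mod (IH m n _); last by lia.
    by rewrite -(modnDr (m + 2 * n) 3); congr modn; lia.
- rewrite US_Y; apply: trialityB.
    apply: triality_mod (trialityY (IH 0%N n (leqnn _))).
    by congr modn; lia.
  case: n IH => [|n] IH; first exact: triality0.
  apply: triality_mod (IH 1%N n _); last by lia.
  by rewrite -(modnDr (1 + 2 * n) 3); congr modn; lia.
Qed.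

(** * Pieri rules in the trihedral algebra *)

Arguments U : simpl never.

Section ThetaAction.
Variables (K : fieldType) (v : K).
Hypothesis q2_neq0 : qint v 2 != 0.

Local Notation theta := (theta_inf v).
Local Notation q2 := (qint v 2).

(** Going back one colour is going forward by two. *)
Definition step (b : bool) : nat := if b then 1 else 2.

Lemma rho_step b (u : 'I_3) :
  (if b then rho u else rho_inv u) = u + (step b)%:R.
Proof. by case: b => //; congr (u + _); apply: val_inj. Qed.

Lemma natr_mod3 m n : (m = n %[mod 3])%N -> m%:R = n%:R :> 'I_3.
Proof. by move=> eq_mn; apply: val_inj; rewrite !Zp_nat /= eq_mn. Qed.

Lemma hword_cons b s u :
  hword v (b :: s) u = hword v s (u + (step b)%:R) * theta u.
Proof. by rewrite /= rho_step. Qed.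

(** The total colour shift along a word. *)
Definition climb (s : seq bool) := sumn (map step s).

Lemma hword_rcons s b u :
  hword v (rcons s b) u = theta (u + (climb s + step b)%:R) * hword v s u.
Proof.
elim: s u => [|c s IH] u; first by rewrite hword_cons.
rewrite rcons_cons !hword_cons IH mulrA; congr (theta _ * _ * _).
by rewrite -addrA -natrD /climb /= addnA.
Qed.

Lemma hword_tail s u : exists x, hword v s u = theta (u + (climb s)%:R) * x.
Proof.
case/lastP: s => [|s b]; first by exists 1; rewrite mulr1 addr0.
exists (hword v s u); rewrite hword_rcons; congr (theta (u + _%:R) * _).
by rewrite /climb map_rcons sumn_rcons.
Qed.

Lemma climb_h k l : climb (nseq k true ++ nseq l false) = (k + 2 * l)%N.
Proof. by rewrite /climb map_cat sumn_cat !map_nseq !sumn_nseq /= mul1n. Qed.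

Lemma theta_h_same k l u :
  theta (u + (k + 2 * l)%:R) * h_inf v k l u = qfact3 v *: h_inf v k l u.
Proof.
rewrite -climb_h /h_inf; have [x ->] := hword_tail (nseq k true ++ nseq l false) u.
by rewrite mulrA theta_inf_sqr scalerAl.
Qed.

Lemma theta_h_up k l u :
  theta (u + (k + 2 * l + 1)%:R) * h_inf v k l u = h_inf v k.+1 l u.
Proof.
rewrite -climb_h [h_inf v k l u]/h_inf -(hword_rcons _ true) hword_choice.
by rewrite -!cats1 !count_cat /= !count_nseq /= !(mul0n, mul1n, addn0, add0n, addn1).
Qed.

Lemma theta_h_down k l u :
  theta (u + (k + 2 * l + 2)%:R) * h_inf v k l u = h_inf v k l.+1 u.
Proof.
rewrite -climb_h [h_inf v k l u]/h_inf -(hword_rcons _ false) hword_choice.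
by rewrite -!cats1 !count_cat /= !count_nseq /= !(mul0n, mul1n, addn0, add0n, addn1).
Qed.

Definition hterm u k l : T_inf v := q2 ^- (k + l) *: h_inf v k l u.

Lemma c_infE m n u : c_inf v m n u = monomial_sum (hterm u) (U m n).
Proof.
apply: eq_bigr => k _; apply: eq_bigr => l _.
by rewrite mulrC -scalerA scaler_int.
Qed.

(** By [U_triality], the leftmost letter of every word in c^{m,n}_u has colour
    u + m + 2n. A generator of that colour rescales all words by the quadratic
    relation; the two other generators prolong all words by a step of the same
    kind, that is, multiply the underlying polynomial by X or by Y, and the
    Pieri rules expand the product. *)
Lemma theta_c_same m n u :
  theta (u + (m + 2 * n)%:R) * c_inf v m n u = qfact3 v *: c_inf v m n u.
Proof.
rewrite c_infE.
rewrite (monomial_sum_morph _ _ (mulrBr _)).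
rewrite (monomial_sum_morph _ _ (scalerBr _)); apply: eq_monomial_sum => k l.
move/U_triality/natr_mod3 <-.
by rewrite -scalerAr theta_h_same !scalerA mulrC.
Qed.

Lemma theta_c_up m n u :
  theta (u + (m + 2 * n + 1)%:R) * c_inf v m n u = q2 *:
    (c_inf v m.+1 n u + (if m is m'.+1 then c_inf v m' n.+1 u else 0)
     + (if n is n'.+1 then c_inf v m n' u else 0)).
Proof.
rewrite [in LHS]c_infE.
rewrite (monomial_sum_morph _ _ (mulrBr _)).
transitivity (q2 *: monomial_sum (hterm u) ('X * U m n)).
  rewrite monomial_sumX (monomial_sum_morph _ _ (scalerBr _)); apply: eq_monomial_sum => k l.
  move/U_triality/natr_mod3 => kl; rewrite natrD -kl -natrD.
  rewrite -scalerAr theta_h_up /hterm scalerA; congr (_ *: _).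
  by rewrite addSn exprS invfM mulrA mulfV // mul1r.
rewrite U_recX 2!monomial_sumD; congr (_ *: (_ + _ + _)); first by rewrite c_infE.
  by case: m => [|m]; rewrite /U_predl ?monomial_sum0 ?c_infE.
by case: n => [|n]; rewrite /U_predr ?monomial_sum0 ?c_infE.
Qed.

Lemma theta_c_down m n u :
  theta (u + (m + 2 * n + 2)%:R) * c_inf v m n u = q2 *:
    (c_inf v m n.+1 u + (if n is n'.+1 then c_inf v m.+1 n' u else 0)
     + (if m is m'.+1 then c_inf v m' n u else 0)).
Proof.
rewrite [in LHS]c_infE.
rewrite (monomial_sum_morph _ _ (mulrBr _)).
transitivity (q2 *: monomial_sum (hterm u) ('Y * U m n)).
  rewrite monomial_sumY (monomial_sum_morph _ _ (scalerBr _)); apply: eq_monomial_sum => k l.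
  move/U_triality/natr_mod3 => kl; rewrite natrD -kl -natrD.
  rewrite -scalerAr theta_h_down /hterm scalerA; congr (_ *: _).
  by rewrite addnS exprS invfM mulrA mulfV // mul1r.
rewrite U_recY 2!monomial_sumD; congr (_ *: (_ + _ + _)); first by rewrite c_infE.
  by case: n => [|n]; rewrite /U_predr ?monomial_sum0 ?c_infE.
by case: m => [|m]; rewrite /U_predl ?monomial_sum0 ?c_infE.
Qed.

Lemma c_inf00 u : c_inf v 0 0 u = theta u.
Proof. by rewrite c_infE U00 monomial_sum1 /hterm expr0 invr1 scale1r. Qed.

End ThetaAction.

(** * The quotient T_e: morphisms and spanning set *)

Section QuotientLift.
Variables (K : fieldType) (A : algType K) (I : twoSidedIdeal A).
Variables (B : algType K) (f : {lrmorphism A -> B}).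

Lemma quot_lift : (forall x, x \in I -> f x = 0) ->
  exists g : {lrmorphism alg_quot I -> B}, forall x, g (alg_pi I x) = f x.
Proof.
move=> fI; pose g := alg_quot_lift fI.
have gE x : g (alg_pi I x) = f x by apply: (alg_quot_liftE fI).
have gZ : scalable g.
  by move=> a x; rewrite -[x]alg_reprK -linearZ /= !gE linearZ.
pose g' : {lrmorphism alg_quot I -> B} :=
  HB.pack g (GRing.isScalable.Build K (alg_quot I) B *:%R g gZ).
by exists g'.
Qed.

End QuotientLift.

Section TruncatedAlgebra.
Variables (K : fieldType) (v : K).

Lemma T_inf_lift (B : algType K) (M : 'I_3 -> B) :
  (forall u, M u * M u = qfact3 v *: M u) ->
  (forall u, M u * M (rho u) * M u = M u * M (rho_inv u) * M u) ->
  exists f : {lrmorphism T_inf v -> B}, forall u, f (theta_inf v u) = M u.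
Proof.
move=> Msqr Mbraid.
have lift3 a b : free_lift M (free_gen K a * free_gen K b * free_gen K a)
    = M a * M b * M a by rewrite 2!rmorphM /= !free_lift_gen.
have [x|f fE] := quot_lift (I := I_inf v) (f := free_lift M).
  apply: ideal_gen_kernel => _ [[u ->]|[u ->]].
    by rewrite raddfB /= linearZ /= rmorphM /= !free_lift_gen Msqr subrr.
  rewrite raddfB; apply/eqP; rewrite subr_eq0; apply/eqP.
  exact: etrans (lift3 _ _) (etrans (Mbraid u) (esym (lift3 _ _))).
by exists f => u; exact: etrans (fE _) (free_lift_gen _ _).
Qed.

Variable e : nat.
Local Notation T := (T_alg v e).

Lemma T_alg_lift (B : algType K) (f : {lrmorphism T_inf v -> B}) :
  (forall m n u, (m + n = e.+1)%N -> f (c_inf v m n u) = 0) ->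
  exists g : {lrmorphism T -> B}, forall x, g (alg_pi (@I_ideal K v e) x) = f x.
Proof.
move=> fc; apply: quot_lift => x.
by apply: ideal_gen_kernel => _ [m [n [u [mn ->]]]]; apply: fc.
Qed.

(** The algebra is generated by the theta_u, and left multiples by generators
    suffice to reach all words. *)
Lemma T_alg_ind (P : T -> Prop) :
  P 1 -> (forall a x y, P x -> P y -> P (a *: x + y)) ->
  (forall u x, P x -> P (theta v e u * x)) -> forall x, P x.
Proof.
move=> P1 Plin Ptheta x; rewrite -[x]alg_reprK -[alg_repr x]alg_reprK.
elim/free_alg_ind: (alg_repr (alg_repr x)) => [|a y z Py Pz|u y Py].
- by rewrite !rmorph1.
- by rewrite !linearP; apply: Plin.
- by rewrite !rmorphM; apply: Ptheta.
Qed.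

Lemma T_alg_morph_unique n (f g : {lrmorphism T -> 'M[K]_n}) :
  (forall u, f (theta v e u) = g (theta v e u)) -> f =1 g.
Proof.
move=> fg; apply: T_alg_ind => [|a x y fx fy|u x fx].
- by rewrite !rmorph1.
- by rewrite [f _]linearP [g _]linearP /= fx fy.
- by rewrite [f _]rmorphM [g _]rmorphM /= fg fx.
Qed.

Definition c_alg m n u : T := alg_pi (@I_ideal K v e) (c_inf v m n u).

Lemma c_alg_top m n u : (m + n = e.+1)%N -> c_alg m n u = 0.
Proof.
by move=> mn; apply/alg_pi_eq0/mem_ideal_gen; exists m, n, u.
Qed.

Hypothesis q2_neq0 : qint v 2 != 0.

Definition in_span (x : T) := exists (a : K) (y : 'I_3 -> 'I_(size (alcove e)) -> K),
  x = a%:A + \sum_u \sum_i y u i *: c_alg (weight i).1 (weight i).2 u.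

Lemma in_span_lin a x y : in_span x -> in_span y -> in_span (a *: x + y).
Proof.
move=> [b [x_ ->]] [c [y_ ->]].
exists (a * b + c), (fun u i => a * x_ u i + y_ u i).
rewrite scalerDr scalerA [in RHS]scalerDl addrACA; congr (_ + _).
rewrite scaler_sumr -big_split; apply: eq_bigr => u _.
rewrite scaler_sumr -big_split; apply: eq_bigr => i _.
by rewrite /= scalerA -scalerDl.
Qed.

Lemma in_span0 : in_span 0.
Proof.
exists 0, (fun _ _ => 0); rewrite scale0r add0r big1 // => u _.
by rewrite big1 // => i _; rewrite scale0r.
Qed.

Lemma in_spanZ a x : in_span x -> in_span (a *: x).
Proof. by move=> xs; rewrite -[_ *: _]addr0; apply: in_span_lin in_span0. Qed.

Lemma in_spanD x y : in_span x -> in_span y -> in_span (x + y).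
Proof. by rewrite -{2}[x]scale1r; apply: in_span_lin. Qed.

Lemma in_span_c m n u : (m + n <= e.+1)%N -> in_span (c_alg m n u).
Proof.
rewrite leq_eqVlt ltnS => /orP[/eqP mn|mn].
  by rewrite c_alg_top //; apply: in_span0.
have [i pti] := weight_surj mn.
exists 0, (fun w j => ((w == u) && (j == i))%:R); rewrite scale0r add0r.
rewrite (bigD1 u) //= [X in _ + X]big1 => [|w /negPf neq_w]; last first.
  by rewrite big1 // => j _; rewrite neq_w scale0r.
rewrite addr0 (bigD1 i) //= [X in _ + X]big1 => [|j /negPf neq_j]; last first.
  by rewrite neq_j andbF scale0r.
by rewrite !eqxx scale1r addr0 pti.
Qed.

Lemma in_span_theta w m n u : (m + n <= e)%N ->
  in_span (theta v e w * c_alg m n u).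
Proof.
move=> mn; rewrite /theta /c_alg -rmorphM /=.
have [j [lt_j ->]] : exists j, (j < 3)%N /\ w = u + (m + 2 * n + j)%:R.
  exists (w - (u + (m + 2 * n)%:R) : 'I_3); split=> //.
  by rewrite natrD addrA natr_Zp addrC subrK.
case: j lt_j => [|[|[|]]] // _.
- by rewrite addn0 theta_c_same linearZ /=; apply/in_spanZ/in_span_c/leqW.
- rewrite theta_c_up // linearZ /= !raddfD /=.
  apply: in_spanD; first apply: in_spanD; apply: in_spanZ.
  + by apply: in_span_c; rewrite addSn.
  + case: m mn => [|m] mn; first by rewrite raddf0; apply: in_span0.
    by apply: in_span_c; rewrite -addSnnS leqW.
  + case: n mn => [|n] mn; first by rewrite raddf0; apply: in_span0.
    by apply: in_span_c; rewrite ltnW // ltnW // -addnS.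
- rewrite theta_c_down // linearZ /= !raddfD /=.
  apply: in_spanD; first apply: in_spanD; apply: in_spanZ.
  + by apply: in_span_c; rewrite addnS.
  + case: n mn => [|n] mn; first by rewrite raddf0; apply: in_span0.
    by apply: in_span_c; rewrite addSnnS leqW.
  + case: m mn => [|m] mn; first by rewrite raddf0; apply: in_span0.
    by apply: in_span_c; rewrite ltnW // ltnW.
Qed.

(** The algebra is spanned by the unit and the c^{m,n}_u with m + n <= e: the
    Pieri rules keep this span stable under the generators because the terms
    leaving the triangle are exactly the ones killed in the quotient. *)
Lemma T_alg_span x : in_span x.
Proof.
elim/T_alg_ind: x => [|a x y|w x [a [y ->]]]; last 1 first.
- rewrite mulrDr mulr_algr mulr_sumr; apply: in_spanD.
    apply: in_spanZ; have -> : theta v e w = c_alg 0 0 w by rewrite /c_alg c_inf00.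
    exact: in_span_c.
  elim/big_ind: _ => [||u _]; [exact: in_span0|exact: in_spanD|].
  rewrite mulr_sumr; elim/big_ind: _ => [||i _]; [exact: in_span0|exact: in_spanD|].
  by rewrite -scalerAr; apply/in_spanZ/in_span_theta/weight_in.
- exists 1, (fun _ _ => 0); rewrite scale1r big1 ?addr0 // => u _.
  by rewrite big1 // => i _; rewrite scale0r.
- exact: in_span_lin.
Qed.

(** The Pieri rules can be solved for c^{m+1,n}_u and c^{0,n+1}_u because [2]_v is
    invertible, so a candidate for the images of the c^{m,n}_u only has to
    satisfy the same rules. *)
Lemma c_inf_morph (B : algType K) (f : {lrmorphism T_inf v -> B})
    (C : nat -> nat -> 'I_3 -> B) :
  (forall u, C 0%N 0%N u = f (theta_inf v u)) ->
  (forall m n u, f (theta_inf v (u + (m + 2 * n + 1)%:R)) * C m n u = qint v 2 *: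
    (C m.+1 n u + (if m is m'.+1 then C m' n.+1 u else 0)
     + (if n is n'.+1 then C m n' u else 0))) ->
  (forall n u, f (theta_inf v (u + (2 * n + 2)%:R)) * C 0%N n u = qint v 2 *:
    (C 0%N n.+1 u + (if n is n'.+1 then C 1%N n' u else 0))) ->
  forall m n u, f (c_inf v m n u) = C m n u.
Proof.
move=> C00 CX CY m n u; move: m n; apply: U_ind => [|m n IH|n IH].
- by rewrite c_inf00 C00.
- have := CX m n u; rewrite -(IH m n) // -rmorphM /= theta_c_up // linearZ /=.
  move/(scalerI q2_neq0); rewrite !raddfD /=.
  case: m IH => [|m] IH; case: n IH => [|n] IH; rewrite ?raddf0 ?addr0 //.
  + by rewrite (IH 0%N n) => [/addIr|]; last lia.
  + by rewrite (IH m 1%N) => [/addIr|]; last lia.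
  + rewrite (IH m n.+2); last by lia.
    by rewrite (IH m.+1 n) => [/addIr/addIr|]; last lia.
- have := CY n u; rewrite -(IH 0%N n) // -[(2 * n)%N]add0n -rmorphM /=.
  rewrite theta_c_down // linearZ /= => /(scalerI q2_neq0).
  rewrite !raddfD /= raddf0 addr0; case: n IH => [|n] IH; rewrite ?raddf0 ?addr0 //.
  by rewrite (IH 1%N n) => [/addIr|]; last lia.
Qed.

End TruncatedAlgebra.

(** * Construction of the representations *)

Section Circulant.
Variable K : comRingType.

Definition circ (a b c : K) : 'M[K]_3 :=
  \matrix_(i, j) (if i == j then a else if i == rho j then b else c).

Lemma circ_mul a b c a' b' c' : circ a b c *m circ a' b' c' =
  circ (a * a' + b * c' + c * b') (a * b' + b * a' + c * c')
       (a * c' + b * b' + c * a').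
Proof.
apply/matrixP => -[[|[|[|i]]] // ?] -[[|[|[|j]]] // ?];
  rewrite !mxE !big_ord_recl big_ord0 !mxE /=; ring.
Qed.

(** The second factor is the adjugate, which is again circulant. *)
Lemma circ_adj a b c : circ a b c *m
    circ (a ^+ 2 - b * c) (c ^+ 2 - a * b) (b ^+ 2 - a * c)
  = (a ^+ 3 + b ^+ 3 + c ^+ 3 - a * b * c *+ 3)%:M.
Proof.
rewrite circ_mul; apply/matrixP => i j; rewrite !mxE.
by case: eqP => _; [rewrite mulr1n; ring|case: ifP => _; rewrite mulr0n; ring].
Qed.

End Circulant.

(** The determinant of circ([3]_v, a, b) cleared of denominators, in the form
    needed to recognize it as the image of a polynomial in v. *)
Lemma cleared_det_morph (A B : comRingType) (f : {rmorphism A -> B}) (t a b : A) :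
  (f t ^+ 4 + f t ^+ 2 + 1) ^+ 3 + f a ^+ 3 * f t ^+ 6 + f b ^+ 3 * f t ^+ 6
    - (f t ^+ 4 + f t ^+ 2 + 1) * (f a * f b) * f t ^+ 4 *+ 3 =
  f ((t ^+ 4 + t ^+ 2 + 1) ^+ 3 + a ^+ 3 * t ^+ 6 + b ^+ 3 * t ^+ 6
    - (t ^+ 4 + t ^+ 2 + 1) * (a * b) * t ^+ 4 *+ 3).
Proof. by rewrite !(rmorphB, rmorphD, rmorphM, rmorphXn, rmorphMn, rmorph1). Qed.

Section AbstractParameter.
Variables (K : fieldType) (v : K).
Hypothesis v_neq0 : v != 0.

Lemma generic_qint_neq0 n : (forall m, (0 < m)%N -> v ^+ m != 1) ->
  (0 < n)%N -> qint v n != 0.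
Proof.
move=> v_gen n_gt0; have diff_neq0 m : (0 < m)%N -> v ^+ m - v ^- m != 0.
  move=> m_gt0; rewrite subr_eq0.
  apply: contraNneq (v_gen (m + m)%N _) => [vm|]; last by rewrite addn_gt0 m_gt0.
  by rewrite exprD {1}vm mulVf // expf_neq0.
by rewrite /qint mulf_neq0 ?diff_neq0 // invr_neq0 //; apply: (diff_neq0 1%N).
Qed.

(** Since [3]_v v^2 = v^4 + v^2 + 1, multiplying the determinant by v^6 makes it
    polynomial in v. *)
Lemma generic_circ_det_neq0 x y : v ^+ 2 != 1 ->
  (v ^+ 4 + v ^+ 2 + 1) ^+ 3 + x ^+ 3 * v ^+ 6 + y ^+ 3 * v ^+ 6
    - (v ^+ 4 + v ^+ 2 + 1) * (x * y) * v ^+ 4 *+ 3 != 0 ->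
  qint v 3 ^+ 3 + x ^+ 3 + y ^+ 3 - qint v 3 * x * y *+ 3 != 0.
Proof.
move=> v2; apply: contraNneq => det0.
have qE : qint v 3 * v ^+ 2 = v ^+ 4 + v ^+ 2 + 1.
  by rewrite /qint; field; rewrite v_neq0 -expr2 subr_eq0.
rewrite -qE; apply/eqP; rewrite -[RHS](mul0r (v ^+ 6)) -det0; ring.
Qed.

End AbstractParameter.

Lemma circ_unit (K : fieldType) (a b c : K) :
  a ^+ 3 + b ^+ 3 + c ^+ 3 - a * b * c *+ 3 != 0 -> circ a b c \in unitmx.
Proof.
set d := _ - _ => d0; have adjE := circ_adj a b c; rewrite -/d in adjE.
suff /mulmx1_unit[] : circ a b c *m (d^-1 *:
  circ (a ^+ 2 - b * c) (c ^+ 2 - a * b) (b ^+ 2 - a * c)) = 1%:M by [].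
by rewrite -scalemxAr adjE scale_scalar_mx mulVf.
Qed.

Section GenericParameter.
Variable R : realType.
Local Notation C := R[i].
Local Notation K := {fraction {poly C}}.
Local Notation v := (vpar R).
Local Notation frac := (@FracField.tofrac {poly C}).

Lemma cst_is_zmod_morphism : zmod_morphism (@cst R).
Proof. by move=> a b; rewrite /cst raddfB /= raddfB. Qed.

Lemma cst_is_monoid_morphism : monoid_morphism (@cst R).
Proof. by split=> [|a b]; rewrite /cst ?rmorph1 // rmorphM /= rmorphM. Qed.

HB.instance Definition _ := GRing.isZmodMorphism.Build C K (@cst R)
  cst_is_zmod_morphism.
HB.instance Definition _ := GRing.isMonoidMorphism.Build C K (@cst R)
  cst_is_monoid_morphism.

Lemma vpar_neq0 : v != 0.
Proof. by rewrite /vpar tofrac_eq0 polyX_eq0. Qed.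

Lemma vpar_exp_neq1 n : (0 < n)%N -> v ^+ n != 1.
Proof.
move=> n_gt0; rewrite /vpar -rmorphXn -(rmorph1 frac) /= tofrac_eq.
by apply/eqP => /(congr1 (size \o polyseq)) /=; rewrite size_polyXn size_poly1; case: n n_gt0.
Qed.

Lemma qint_neq0 n : (0 < n)%N -> qint v n != 0.
Proof. exact/generic_qint_neq0/vpar_exp_neq1/vpar_neq0. Qed.

Lemma qfact3_neq0 : qfact3 v != 0.
Proof. exact: mulf_neq0 (qint_neq0 _) (qint_neq0 _). Qed.

(** The determinant cleared of denominators is a polynomial in v whose value at
    v = 0 is one. *)
Lemma circ_det_neq0 (x y : C) : qint v 3 ^+ 3 + cst x ^+ 3 + cst y ^+ 3
    - qint v 3 * cst x * cst y *+ 3 != 0.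
Proof.
apply: (@generic_circ_det_neq0 _ v).
- exact: vpar_neq0.
- exact: (vpar_exp_neq1 (n := 2)).
rewrite [X in X != 0](cleared_det_morph frac 'X x%:P y%:P).
rewrite tofrac_eq0; apply/eqP => /(congr1 (horner^~ 0)).
rewrite !hornerE /= !expr0n /=.
rewrite !(mulr0, addr0, add0r, expr1n, subr0, mul0rn, oppr0) => /eqP.
by rewrite oner_eq0.
Qed.

(** Its u-th row is the nonzero row of the image of theta_u in M_z, divided by
    [2]_v. *)
Definition rowmx (z : C) : 'M[K]_3 := circ (qint v 3) (cst z) (cst (conjc z)).

Lemma rowmx_unit z : rowmx z \in unitmx.
Proof.
exact/circ_unit/circ_det_neq0.
Qed.

End GenericParameter.

Section DeltaProducts.
Variables (K : comRingType) (n : nat) (P : 'M[K]_n).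

Lemma delta_mulmxE (a b i j : 'I_n) : (delta_mx a b *m P) i j = P b j *+ (i == a).
Proof.
rewrite mxE (bigD1 b) //= mxE eqxx andbT big1 ?addr0 => [|k /negPf neq_k].
  by rewrite mulr_natl.
by rewrite mxE neq_k andbF mul0r.
Qed.

(** Matrices of this form multiply like matrix units up to an entry of P. *)
Lemma delta_mulmx_mul (a b c d : 'I_n) :
  (delta_mx a b *m P) *m (delta_mx c d *m P) = P b c *: (delta_mx a d *m P).
Proof.
apply/matrixP => i j; rewrite [RHS]mxE [LHS]mxE (bigD1 c) //= big1 => [|k /negPf neq_k].
  by rewrite !delta_mulmxE eqxx mulr1n addr0 mulrnAl mulrnAr.
by rewrite !delta_mulmxE neq_k mulr0n mulr0.
Qed.

End DeltaProducts.

Section AbstractRepresentations.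
Variables (K : fieldType) (v : K) (e : nat).
Hypothesis q2_neq0 : qint v 2 != 0.
Local Notation T := (T_alg v e).
(** W m n stands for the value of U_{m,n} at (x, y), and the representations are
    built over any field from the recursions alone. *)
Variables (x y : K) (W : nat -> nat -> K).
Hypothesis W00 : W 0%N 0%N = 1.
Hypothesis WX : forall m n, W m.+1 n = x * W m n
    - (if m is m'.+1 then W m' n.+1 else 0) - (if n is n'.+1 then W m n' else 0).
Hypothesis WY : forall n, W 0%N n.+1 = y * W 0%N n
    - (if n is n'.+1 then W 1%N n' else 0).

Local Notation P := (circ (qint v 3) x y).

Lemma circ_same w : P w w = qint v 3.
Proof. by rewrite mxE eqxx. Qed.

Lemma circ_up (w : 'I_3) : P (w + 1%:R) w = x.
Proof. by rewrite mxE; case: w => [[|[|[|w]]] // ?]. Qed.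

Lemma circ_down (w : 'I_3) : P (w + 2%:R) w = y.
Proof. by rewrite mxE; case: w => [[|[|[|w]]] // ?]. Qed.

Lemma circ_rho (w : 'I_3) : P w (rho w) * P (rho w) w = P w (rho_inv w) * P (rho_inv w) w.
Proof.
by rewrite !mxE; case: w => [[|[|[|w]]] // ?]; rewrite /= mulrC.
Qed.

(** The matrix delta_{wu} P has row u of P in row w; up to [2]_v, the image of
    theta_w' multiplies it by the entry P_{w',w} and moves that row to row w',
    which for the neighbouring colours realizes multiplication by x and y. *)
Lemma rep3_abstract : (forall m n, (m + n = e.+1)%N -> W m n = 0) ->
  exists phi : {lrmorphism T -> 'M[K]_3},
    (forall u, phi (theta v e u) = qint v 2 *: (delta_mx u u *m P)) /\
    forall m n u, phi (c_alg v e m n u) =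
      (qint v 2 * W m n) *: (delta_mx (u + (m + 2 * n)%:R) u *m P).
Proof.
move=> W_top; pose M u : 'M[K]_3 := qint v 2 *: (delta_mx u u *m P).
have MM a b (k : K) c : M a *m (k *: (delta_mx b c *m P))
    = (qint v 2 * k * P a b) *: (delta_mx a c *m P).
  by rewrite -scalemxAl -scalemxAr delta_mulmx_mul !scalerA.
have [u|u|f fM] := @T_inf_lift _ v ('M[K]_3) M.
- by rewrite [LHS]MM circ_same scalerA /qfact3; congr (_ *: _); ring.
- rewrite -!mulrA; rewrite [M (rho u) * M u]MM [M (rho_inv u) * M u]MM.
  rewrite [LHS]MM [RHS]MM; congr (_ *: _).
  by rewrite -![_ * (_ * P _ u) * _]mulrA -![_ * P _ u * _]mulrA
    ![P _ u * _]mulrC circ_rho.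
pose Cf m n u : 'M[K]_3 := (qint v 2 * W m n) *: (delta_mx (u + (m + 2 * n)%:R) u *m P).
have fc m n u : f (c_inf v m n u) = Cf m n u.
  apply: (c_inf_morph q2_neq0) m n u => [u|m n u|n u].
  - by rewrite fM /Cf W00 mulr1 addr0.
  - rewrite fM [LHS]MM natrD addrA circ_up /Cf -addrA -natrD.
    have -> : qint v 2 * (qint v 2 * W m n) * x = qint v 2 * (qint v 2 * (x * W m n)).
      by ring.
    rewrite -scalerA; congr (_ *: _); have -> : x * W m n = W m.+1 n
        + (if m is m'.+1 then W m' n.+1 else 0) + (if n is n'.+1 then W m n' else 0).
      by rewrite WX addrAC !subrK.
    rewrite !mulrDr !scalerDl; congr (_ + _ + _).
    + by congr (_ *: (delta_mx (u + _) u *m P)); apply: natr_mod3; congr modn; lia.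
    + case: m => [|m]; first by rewrite mulr0 scale0r.
      by congr (_ *: (delta_mx (u + _) u *m P)); apply: natr_mod3; congr modn; lia.
    + case: n => [|n]; first by rewrite mulr0 scale0r.
      congr (_ *: (delta_mx (u + _) u *m P)); apply: natr_mod3.
      by rewrite -(modnDr (m + 2 * n) 3); congr modn; lia.
  - rewrite fM [LHS]MM natrD addrA circ_down /Cf -addrA -natrD.
    have -> : qint v 2 * (qint v 2 * W 0%N n) * y = qint v 2 * (qint v 2 * (y * W 0%N n)).
      by ring.
    rewrite -scalerA; congr (_ *: _); have -> : y * W 0%N n = W 0%N n.+1
        + (if n is n'.+1 then W 1%N n' else 0).
      by rewrite WY subrK.
    rewrite mulrDr scalerDl; congr (_ + _).
    + by congr (_ *: (delta_mx (u + _) u *m P)); apply: natr_mod3; congr modn; lia.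
    + case: n => [|n]; first by rewrite mulr0 scale0r.
      congr (_ *: (delta_mx (u + _) u *m P)); apply: natr_mod3.
      by rewrite -(modnDr (1 + 2 * n) 3); congr modn; lia.
have [m n u mn|g gE] := @T_alg_lift _ v e ('M[K]_3) f.
  by rewrite fc /Cf W_top // mulr0 scale0r.
by exists g; split=> [u|m n u]; rewrite [LHS]gE ?fM ?fc.
Qed.

(** At (0,0) the Pieri rules are compatible with scalars: a generator prolonging
    the words of c^{m,n}_u has a colour other than u when 3 divides m + 2n, and
    otherwise U_{m,n}(0,0) = 0. *)
Lemma rep1_abstract (alpha : 'I_3 -> K) : x = 0 -> y = 0 ->
  (forall m n, ((m + 2 * n) %% 3 != 0)%N -> W m n = 0) ->
  (forall u, alpha u * alpha u = qfact3 v * alpha u) ->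
  (forall u w, u != w -> alpha u * alpha w = 0) ->
  (forall m n u, (m + n = e.+1)%N -> alpha u * W m n = 0) ->
  exists phi : {lrmorphism T -> 'M[K]_1},
    (forall u, phi (theta v e u) = (alpha u)%:M) /\
    forall m n u, phi (c_alg v e m n u) = (alpha u * W m n)%:M.
Proof.
move=> x0 y0 W_col alpha2 alpha_orth W_top.
have scalM (a b : K) : a%:M * b%:M = (a * b)%:M :> 'M[K]_1.
  exact: esym (scalar_mxM _ _ _).
have [u|u|f fM] := @T_inf_lift _ v ('M[K]_1) (fun u => (alpha u)%:M).
- by rewrite scalM alpha2 scale_scalar_mx.
- rewrite !scalM !alpha_orth ?mul0r //; by case: u => [[|[|[|u]]] // ?].
have alpha_step u d m n : (d %% 3 != 0)%N ->
    alpha (u + (m + 2 * n + d)%:R) * (alpha u * W m n) = 0.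
  move=> d0; have [mn|mn] := eqVneq ((m + 2 * n) %% 3)%N 0%N; last first.
    by rewrite W_col // !mulr0.
  rewrite mulrA alpha_orth ?mul0r //; rewrite -[X in _ != X]addr0 (inj_eq (addrI u)).
  by rewrite -val_eqE /= Zp_nat /= -modnDml mn.
have fc m n u : f (c_inf v m n u) = (alpha u * W m n)%:M.
  pose Cf m n u : 'M[K]_1 := (alpha u * W m n)%:M.
  apply: (c_inf_morph q2_neq0 (C := Cf)) m n u => [u|m n u|n u]; rewrite /Cf.
  - by rewrite fM W00 mulr1.
  - rewrite fM scalM alpha_step // raddf0.
    have W0 : W m.+1 n + (if m is m'.+1 then W m' n.+1 else 0)
        + (if n is n'.+1 then W m n' else 0) = 0.
      by rewrite WX x0 mul0r addrAC !subrK.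
    have -> : (if m is m'.+1 then (alpha u * W m' n.+1)%:M else 0) =
        (alpha u * (if m is m'.+1 then W m' n.+1 else 0))%:M :> 'M[K]_1.
      by case: (m) => [|m']; rewrite ?mulr0 ?raddf0.
    have -> : (if n is n'.+1 then (alpha u * W m n')%:M else 0) =
        (alpha u * (if n is n'.+1 then W m n' else 0))%:M :> 'M[K]_1.
      by case: (n) => [|n']; rewrite ?mulr0 ?raddf0.
    by rewrite -!raddfD /= -!mulrDr W0 mulr0 raddf0 scaler0.
  - rewrite fM scalM -[(2 * n)%N]add0n alpha_step // raddf0.
    have W0 : W 0%N n.+1 + (if n is n'.+1 then W 1%N n' else 0) = 0.
      by rewrite WY y0 mul0r subrK.
    have -> : (if n is n'.+1 then (alpha u * W 1%N n')%:M else 0) =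
        (alpha u * (if n is n'.+1 then W 1%N n' else 0))%:M :> 'M[K]_1.
      by case: (n) => [|n']; rewrite ?mulr0 ?raddf0.
    by rewrite -!raddfD /= -!mulrDr W0 mulr0 raddf0 scaler0.
have [m n u mn|g gE] := @T_alg_lift _ v e ('M[K]_1) f.
  by rewrite fc W_top // raddf0.
by exists g; split=> [u|m n u]; rewrite [LHS]gE ?fM ?fc.
Qed.

End AbstractRepresentations.

(** * Colour components and the cyclic Fourier transform *)

Section CyclicFourier.
Variables (K : fieldType) (w : K) (t : nat).
Hypothesis w_sum : 1 + w + w ^+ 2 = 0.
Hypothesis three_neq0 : 3%:R != 0 :> K.

Lemma w_cube : w ^+ 3 = 1.
Proof.
apply/eqP; rewrite -subr_eq0 (_ : _ - 1 = (w - 1) * (1 + w + w ^+ 2)); last by ring.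
by rewrite w_sum mulr0.
Qed.

Lemma w_mod n : w ^+ n = w ^+ (n %% 3).
Proof. by rewrite expr_mod // w_cube. Qed.

Lemma char_sum n : \sum_(r < 3) w ^+ (r * n) = if (n %% 3 == 0)%N then 3%:R else 0.
Proof.
rewrite !big_ord_recl big_ord0 /= !mul0n addr0 expr0 !mul1n mulnC exprM [w ^+ n]w_mod.
have : (n %% 3 < 3)%N by rewrite ltn_mod.
case: (n %% 3)%N => [|[|[|]]] // _ /=.
- by rewrite expr0 expr1n; ring.
- by rewrite expr1 addrA.
- rewrite -exprM (w_mod (2 * 2)) /= expr1 -w_sum; ring.
Qed.

(** W k i is the value of the i-th polynomial at the k-th point, col i the class
    of that polynomial modulo the root lattice, and rot r the multiplication of
    points by the r-th power of a cube root of unity. *)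
Variables (col : 'I_t -> nat) (W : 'I_t -> 'I_t -> K) (rot : 'I_3 -> 'I_t -> 'I_t).
Hypothesis W_unit : (\matrix_(i, k) W k i) \in unitmx.
Hypothesis W_rot : forall r k i, W (rot r k) i = w ^+ (r * col i) * W k i.

(** The value at the k-th point of the summand of class d in the polynomial with
    coefficients y. *)
Definition part (d : nat) (y : 'I_t -> K) k :=
  \sum_(i | (col i == d %[mod 3])%N) y i * W k i.

Lemma partition_col (V : nmodType) (F : 'I_t -> V) :
  \sum_i F i = \sum_(d < 3) \sum_(i | (col i == d %[mod 3])%N) F i.
Proof.
rewrite (partition_big (fun i => inord (col i %% 3) : 'I_3) xpredT) //=.
apply: eq_bigr => d _; apply: eq_bigl => i.
by rewrite -val_eqE /= inordK ?ltn_mod // [(d %% 3)%N]modn_small.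
Qed.

Lemma eval_rot y r k : \sum_i y i * W (rot r k) i = \sum_(d < 3) w ^+ (r * d) * part d y k.
Proof.
rewrite partition_col; apply: eq_bigr => d _; rewrite mulr_sumr.
apply: eq_bigr => i /eqP col_i; rewrite W_rot mulrCA; congr (_ * _).
by rewrite w_mod -modnMmr col_i modnMmr -w_mod.
Qed.

(** The values on an orbit are linear combinations of the components at its
    representative, so all values vanish and the invertibility of the matrix of
    values applies. *)
Lemma part_injective (S zero : pred 'I_t) (y : 'I_t -> K) :
  (forall k, zero k \/ exists r s, S s /\ k = rot r s) ->
  (forall k, zero k -> \sum_i y i * W k i = 0) ->
  (forall d k, S k -> part d y k = 0) -> forall i, y i = 0.
Proof.
move=> cover y_zero y_part.
have yW : (\row_i y i) *m (\matrix_(i, k) W k i) = 0.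
  apply/rowP => k; rewrite !mxE; under eq_bigr do rewrite !mxE.
  have [/y_zero //|[r [s [Ss ->]]]] := cover k.
  by rewrite eval_rot big1 // => d _; rewrite y_part ?mulr0.
move=> i; have := congr1 (fun B => (B *m invmx (\matrix_(i, k) W k i)) 0 i) yW.
by rewrite mulmxK // mul0mx !mxE.
Qed.

(** Coefficients of the polynomial taking the value one at the k-th point and
    zero at the others. *)
Definition dual (k i : 'I_t) : K := invmx (\matrix_(i, k) W k i) k i.

Lemma dualE k l : \sum_i dual k i * W l i = (k == l)%:R.
Proof.
have := congr1 (fun B : 'M_t => B k l) (mulVmx W_unit); rewrite !mxE => <-.
by apply: eq_bigr => i _; rewrite mxE.
Qed.

(** Fourier inversion over the cyclic group of order three isolates the
    component of one colour of the dual basis. *)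
Lemma part_dual d k l :
  3%:R * part d (dual k) l = \sum_(r < 3) w ^+ (r * (2 * d)) * (k == rot r l)%:R.
Proof.
under [RHS]eq_bigr do rewrite -dualE mulr_sumr.
rewrite exchange_big /part mulr_sumr big_mkcond; apply: eq_bigr => i _ /=.
have regroup (r : 'I_3) : w ^+ (r * (2 * d)) * (dual k i * W (rot r l) i)
    = w ^+ (r * (2 * d + col i)) * (dual k i * W l i).
  by rewrite W_rot mulnDr exprD; ring.
under eq_bigr do rewrite regroup.
rewrite -mulr_suml char_sum.
have -> : ((2 * d + col i) %% 3 == 0)%N = (col i == d %[mod 3])%N.
  by apply/eqP/eqP; lia.
by case: ifP => _; rewrite ?mulr0 ?mul0r.
Qed.

Hypothesis rot0 : forall k, rot 0 k = k.

(** On a free orbit the sum in [part_dual] has the single nonzero term r = 0; the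
    factor 3 normalizes it. *)
Lemma isolate_orbit d k : (forall r, rot r k = k -> r = 0) ->
  exists2 y : 'I_t -> K, part d y k = 1 &
    forall l, (forall r, rot r l <> k) -> part d y l = 0.
Proof.
move=> k_free; exists (fun i => 3%:R * dual k i) => [|l l_out];
  rewrite /part; under eq_bigr do rewrite -mulrA;
  rewrite -mulr_sumr -/(part d (dual k) _) part_dual.
- rewrite (bigD1 0) //= mul0n expr0 mul1r rot0 eqxx big1 ?addr0 // => r r0.
  case: eqP => [/esym/k_free r_eq0|_]; last by rewrite mulr0.
  by rewrite r_eq0 eqxx in r0.
- by rewrite big1 // => r _; case: eqP => [/esym/l_out|_]; rewrite ?mulr0.
Qed.

(** At a fixed point all three terms of the sum in [part_dual] equal one. *)
Lemma isolate_fixed k : (forall r, rot r k = k) ->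
  exists2 y : 'I_t -> K, part 0 y k = 1 &
    forall l, (forall r, rot r l <> k) -> part 0 y l = 0.
Proof.
move=> k_fixed; exists (dual k) => [|l l_out]; apply: (mulfI three_neq0);
  rewrite part_dual; under eq_bigr do rewrite !muln0 expr0 mul1r.
- by under eq_bigr do rewrite k_fixed eqxx; rewrite sumr_const card_ord mulr1.
- by rewrite big1 ?mulr0 // => r _; case: eqP => [/esym/l_out|].
Qed.

End CyclicFourier.

(** * Separating the representations *)

Lemma natr_I3_eq m n : (m%:R == n%:R :> 'I_3) = (m == n %[mod 3])%N.
Proof. by rewrite -val_eqE /= !Zp_nat. Qed.

Section Separation.
Variables (K : fieldType) (v : K) (e : nat).
Hypotheses (q2_neq0 : qint v 2 != 0) (qfact3_neq0 : qfact3 v != 0).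
Local Notation T := (T_alg v e).
Local Notation t := (size (alcove e)).
Local Notation c i u := (c_alg v e (weight i).1 (weight i).2 u).

Definition colour (i : 'I_t) : nat := ((weight i).1 + 2 * (weight i).2)%N.

Variables (w : K) (W : 'I_t -> 'I_t -> K) (rot : 'I_3 -> 'I_t -> 'I_t).
Hypothesis w_sum : 1 + w + w ^+ 2 = 0.
Hypothesis three_neq0 : 3%:R != 0 :> K.
Hypothesis W_unit : (\matrix_(i, k) W k i) \in unitmx.
Hypothesis W_rot : forall r k i, W (rot r k) i = w ^+ (r * colour i) * W k i.
Hypothesis rot0 : forall k, rot 0 k = k.

(** The points are indexed by ordinals; [zero] singles out the origin, J indexes
    representatives of the other orbits, and U the colours carrying a nonzero
    one-dimensional representation: all three if the origin is a point, and
    none otherwise. *)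
Variables (zero : pred 'I_t) (U J : finType).
Variables (node : U -> 'I_3) (rep : J -> 'I_t).
Hypothesis zero_fixed : forall r k, zero k -> rot r k = k.
Hypothesis zero_rot : forall r k, zero (rot r k) -> zero k.
Hypothesis node_inj : injective node.
Hypothesis zero_node : forall k x, zero k -> exists u, node u = x.
Hypothesis node_zero : forall u : U, exists k, zero k.
Hypothesis rep_free : forall r i j, rot r (rep i) = rep j -> i = j /\ r = 0.
Hypothesis rep_nonzero : forall j, ~~ zero (rep j).
Hypothesis cover : forall k, zero k \/ exists r j, k = rot r (rep j).

Variables (phi0 : {lrmorphism T -> 'M[K]_1}) (phi1 : U -> {lrmorphism T -> 'M[K]_1})
  (phi3 : J -> {lrmorphism T -> 'M[K]_3}) (P : J -> 'M[K]_3).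
Hypothesis P_unit : forall j, P j \in unitmx.
Hypothesis phi0E : forall (i : 'I_t) x, phi0 (c i x) = 0.
Hypothesis phi1E : forall u k (i : 'I_t) x, zero k ->
  phi1 u (c i x) = (qfact3 v * W k i *+ (x == node u))%:M.
Hypothesis phi3E : forall j (i : 'I_t) x, phi3 j (c i x) =
  (qint v 2 * W (rep j) i) *: (delta_mx (x + (colour i)%:R) x *m P j).

Local Notation part := (part colour W).

(** Under every representation such an element only sees the component of class
    d of the polynomial with coefficients y. *)
Definition colour_elt d (y : 'I_t -> K) x : T :=
  \sum_(i | (colour i == d %[mod 3])%N) y i *: c i x.

Lemma phi0_colour_elt d y x : phi0 (colour_elt d y x) = 0.
Proof.
by rewrite raddf_sum big1 // => i _; rewrite /= linearZ /= phi0E scaler0.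
Qed.

Lemma phi1_colour_elt u k d y x : zero k ->
  phi1 u (colour_elt d y x) = (qfact3 v * part d y k *+ (x == node u))%:M.
Proof.
move=> k0; rewrite raddf_sum /part mulr_sumr -sumrMnl raddf_sum.
apply: eq_bigr => i _; rewrite /= linearZ /= (phi1E _ _ _ k0) scale_scalar_mx.
by rewrite mulrnAr mulrCA.
Qed.

Lemma phi3_colour_elt j d y x : phi3 j (colour_elt d y x) =
  (qint v 2 * part d y (rep j)) *: (delta_mx (x + d%:R) x *m P j).
Proof.
rewrite raddf_sum /part mulr_sumr scaler_suml; apply: eq_bigr => i col_i.
rewrite /= linearZ /= phi3E scalerA mulrCA.
by congr (_ *: (delta_mx (_ + _) _ *m _)); apply/eqP; rewrite natr_I3_eq.
Qed.

(** The trivial representation detects the coefficient of the unit. The matrix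
    entry (x + d, x) of M_z detects the component of class d at z of the
    coefficients of the c^{m,n}_x, and the one-dimensional representations
    detect the value at the origin. *)
Lemma joint_injective (s : T) : phi0 s = 0 -> (forall u, phi1 u s = 0) ->
  (forall j, phi3 j s = 0) -> s = 0.
Proof.
have [a [y ->]] := T_alg_span q2_neq0 s => s0 s1 s3.
have a0 : a = 0.
  move: s0; rewrite raddfD /= linearZ /= rmorph1 raddf_sum /= big1 => [|x _].
    by rewrite addr0 scale_scalar_mx mulr1 => /matrixP/(_ 0 0); rewrite !mxE.
  by rewrite raddf_sum big1 // => i _; rewrite /= linearZ /= phi0E scaler0.
suff y0 x i : y x i = 0.
  rewrite a0 scale0r add0r big1 // => x _; rewrite big1 // => i _.
  by rewrite y0 scale0r.
apply: (part_injective w_sum W_unit W_rot (S := [pred k | k \in codom rep]) (zero := zero)).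
- move=> k; have [k0|[r [j ->]]] := cover k; [by left|right].
  by exists r, (rep j); split=> //=; rewrite codom_f.
- move=> k k0; have [u node_u] := zero_node x k0.
  have := s1 u; rewrite a0 scale0r add0r raddf_sum (bigD1 x) //=.
  rewrite [X in _ + X]big1 => [|x' neq_x]; last first.
    rewrite raddf_sum big1 // => i' _.
    by rewrite /= linearZ /= (phi1E _ _ _ k0) node_u (negPf neq_x) raddf0 scaler0.
  rewrite addr0 raddf_sum => /matrixP/(_ 0 0); rewrite summxE mxE => sum0.
  apply: (mulfI qfact3_neq0); rewrite mulr0 -[RHS]sum0 mulr_sumr.
  apply: eq_bigr => i' _; rewrite /= linearZ /= (phi1E _ _ _ k0) node_u eqxx.
  by rewrite !mxE eqxx mulr1n mulrCA.
- move=> d _ /codomP[j ->]; have := s3 j.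
  pose B := \sum_x \sum_i' (y x i' * W (rep j) i') *:
    delta_mx (x + (colour i')%:R : 'I_3) x : 'M[K]_3.
  rewrite a0 scale0r add0r (_ : phi3 j _ = qint v 2 *: (B *m P j)).
    move/(congr1 (fun D => (qint v 2)^-1 *: (D *m invmx (P j)))).
    rewrite mul0mx scaler0 -scalemxAl scalerA mulVf // scale1r mulmxK //.
    move/matrixP/(_ (x + d%:R) x); rewrite [RHS]mxE /B summxE (bigD1 x) //=.
    rewrite [X in _ + X]big1 => [|x' neq_x]; last first.
      rewrite summxE big1 // => i' _.
      by rewrite !mxE [x == x']eq_sym (negPf neq_x) andbF mulr0.
    rewrite addr0 => <-; rewrite summxE /part big_mkcond; apply: eq_bigr => i' _.
    rewrite !mxE eqxx andbT (inj_eq (addrI x)) natr_I3_eq eq_sym.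
    by case: ifP; rewrite ?mulr1 ?mulr0.
  rewrite raddf_sum mulmx_suml scaler_sumr; apply: eq_bigr => x' _.
  rewrite raddf_sum mulmx_suml scaler_sumr; apply: eq_bigr => i' _.
  by rewrite /= linearZ /= phi3E -scalemxAl !scalerA mulrCA.
Qed.

(** Isolating the orbit in the class a - x gives an element that maps to
    delta_{ax} P in one representation and to zero in the others; combining
    these with the b-th row of the inverse of P gives delta_{ab}. *)
Lemma orbit_unit j a b : exists x, [/\ phi0 x = 0, forall u, phi1 u x = 0,
  phi3 j x = delta_mx a b & forall j', j' != j -> phi3 j' x = 0].
Proof.
pose d x : nat := val (a - x : 'I_3).
have dE x : x + (d x)%:R = a by rewrite /d natr_Zp addrC subrK.
have isolate x : exists y : 'I_t -> K, part (d x) y (rep j) = 1 /\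
    forall l, (forall r, rot r l <> rep j) -> part (d x) y l = 0.
  have [r /rep_free[]//|y y1 y0] := isolate_orbit w_sum three_neq0 W_unit W_rot
    rot0 (d x) (k := rep j).
  by exists y.
have {isolate} [y yP] := fin_all_exists isolate.
have y1 x : part (d x) (y x) (rep j) = 1 by have [] := yP x.
have y0 x l : (forall r, rot r l <> rep j) -> part (d x) (y x) l = 0.
  by have [_] := yP x; apply.
pose coef x := invmx (P j) b x * (qint v 2)^-1.
exists (\sum_x coef x *: colour_elt (d x) (y x) x); split=> [|u||j' neq_j].
- by rewrite raddf_sum big1 // => x _; rewrite /= linearZ /= phi0_colour_elt scaler0.
- have [k k0] := node_zero u; rewrite raddf_sum big1 // => x _.
  rewrite /= linearZ /= (phi1_colour_elt _ _ _ _ k0) y0 => [|r].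
    by rewrite mulr0 mul0rn raddf0 scaler0.
  by rewrite zero_fixed // => k_rep; have := rep_nonzero j; rewrite -k_rep k0.
- rewrite raddf_sum -[RHS](mulmxKV (P_unit j)).
  have -> : delta_mx a b *m invmx (P j) = \sum_x invmx (P j) b x *: delta_mx a x.
    apply/matrixP => i' j''; rewrite delta_mulmxE summxE (bigD1 j'') //=.
    rewrite big1 => [|x neq_x]; last first.
      by rewrite !mxE [j'' == x]eq_sym (negPf neq_x) andbF mulr0.
    by rewrite !mxE eqxx andbT addr0 mulr_natr.
  rewrite mulmx_suml; apply: eq_bigr => x _.
  rewrite /= linearZ /= phi3_colour_elt y1 dE mulr1 scalerA /coef divfK //.
  by rewrite -scalemxAl.
- rewrite raddf_sum big1 // => x _.
  rewrite /= linearZ /= phi3_colour_elt y0 ?mulr0 ?scale0r ?scaler0 // => r.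
  by move=> /rep_free[eq_j _]; rewrite eq_j eqxx in neq_j.
Qed.

Lemma node_unit u : exists x, [/\ phi0 x = 0, phi1 u x = 1%:M,
  forall u', u' != u -> phi1 u' x = 0 & forall j, phi3 j x = 0].
Proof.
have [k k0] := node_zero u.
have [r|y y1 y0] := isolate_fixed w_sum three_neq0 W_unit W_rot (k := k).
  exact: zero_fixed.
exists ((qfact3 v)^-1 *: colour_elt 0 y (node u)); split=> [||u' neq_u|j].
- by rewrite linearZ /= phi0_colour_elt scaler0.
- rewrite linearZ /= (phi1_colour_elt _ _ _ _ k0) y1 eqxx mulr1 mulr1n.
  by rewrite scale_scalar_mx mulVf.
- rewrite linearZ /= (phi1_colour_elt _ _ _ _ k0) (inj_eq node_inj).
  by rewrite eq_sym (negPf neq_u) mulr0n raddf0 scaler0.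
- rewrite linearZ /= phi3_colour_elt y0 ?mulr0 ?scale0r ?scaler0 // => r rk.
  by have := rep_nonzero j; rewrite (zero_rot (r := r)) // rk.
Qed.

(** The unit minus the central idempotents of all other blocks. *)
Lemma trivial_unit : exists x, [/\ phi0 x = 1%:M, forall u, phi1 u x = 0 &
  forall j, phi3 j x = 0].
Proof.
have [x1 x1P] := fin_all_exists node_unit.
have [x3 x3P] := fin_all_exists (fun j => fin_all_exists (fun a => orbit_unit j a a)).
pose s1 := \sum_u x1 u; pose s3 := \sum_j \sum_a x3 j a.
exists (1 - s1 - s3); split=> [|u|j].
- have p1 : phi0 s1 = 0 by rewrite raddf_sum big1 // => u _; case: (x1P u).
  have p3 : phi0 s3 = 0.
    rewrite raddf_sum big1 // => j _; rewrite raddf_sum big1 // => a _.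
    by case: (x3P j a).
  by rewrite !raddfB /= p1 p3 rmorph1 !subr0.
- have p1 : phi1 u s1 = 1%:M.
    rewrite raddf_sum (bigD1 u) //= big1 => [|u' neq_u].
      by case: (x1P u) => _ ->; rewrite addr0.
    by case: (x1P u') => _ _ -> //; rewrite eq_sym.
  have p3 : phi1 u s3 = 0.
    rewrite raddf_sum big1 // => j _; rewrite raddf_sum big1 // => a _.
    by rewrite /=; case: (x3P j a) => _ ->.
  by rewrite !raddfB /= p1 p3 rmorph1 subr0 subrr.
- have p1 : phi3 j s1 = 0.
    by rewrite raddf_sum big1 // => u _ /=; case: (x1P u) => _ _ _ ->.
  have p3 : phi3 j s3 = 1%:M.
    rewrite raddf_sum (bigD1 j) //= [X in _ + X]big1 => [|j' neq_j].
      rewrite addr0 raddf_sum (eq_bigr (fun a => delta_mx a a)) => [|a _]; last first.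
        by case: (x3P j a).
      rewrite [RHS]matrix_sum_delta; apply: eq_bigr => a _.
      rewrite (bigD1 a) //= big1 => [|b neq_b]; first by rewrite mxE eqxx scale1r addr0.
      by rewrite mxE eq_sym (negPf neq_b) scale0r.
    rewrite raddf_sum big1 // => a _ /=; case: (x3P j' a) => _ _ _ -> //.
    by rewrite eq_sym.
  by rewrite !raddfB /= p1 p3 rmorph1 subr0 subrr.
Qed.

End Separation.

(** * The labelled simple representations *)

Local Open Scope classical_set_scope.

Section Classification.
Variables (R : realType) (e : nat).
Local Notation C := R[i].
Local Notation K := {fraction {poly C}}.
Local Notation v := (vpar R).
Local Notation T := (T_alg v e).
Local Notation t := (size (alcove e)).
Local Notation z k := (@eigval R e k).

Lemma q2_neq0 : qint v 2 != 0. Proof. exact: qint_neq0. Qed.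

Definition Uval m n (x : C) : K := cst (Ueval m n x (conjc x)).

Lemma Uval00 x : Uval 0 0 x = 1.
Proof. by rewrite /Uval Ueval00 rmorph1. Qed.

Lemma UvalX x m n : Uval m.+1 n x = cst x * Uval m n x
    - (if m is m'.+1 then Uval m' n.+1 x else 0)
    - (if n is n'.+1 then Uval m n' x else 0).
Proof.
rewrite /Uval UevalX !rmorphB rmorphM /=.
by case: m => [|m]; case: n => [|n]; rewrite ?rmorph0.
Qed.

Lemma UvalY x n : Uval 0 n.+1 x = cst (conjc x) * Uval 0 n x
    - (if n is n'.+1 then Uval 1 n' x else 0).
Proof.
rewrite /Uval UevalY !rmorphB rmorphM /=.
by case: n => [|n]; rewrite ?rmorph0.
Qed.

Lemma rep3_exists (x : C) : real_points e x ->
  exists phi : {lrmorphism T -> 'M[K]_(rep_dim (Label3 x))}, is_rep phi /\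
    forall m n u, phi (c_alg v e m n u) =
      (qint v 2 * Uval m n x) *: (delta_mx (u + (m + 2 * n)%:R) u *m rowmx x).
Proof.
move=> Vx; have [m n mn|phi [phiE phic]] := rep3_abstract (e := e) q2_neq0
  (Uval00 x) (UvalX x) (UvalY x).
  by rewrite /Uval Vx // rmorph0.
exists phi; split=> // u; rewrite phiE; congr (_ *: _).
apply/matrixP => i j; rewrite delta_mulmxE !mxE.
by case: u i j => [[|[|[|u]]] // ?] [[|[|[|i]]] // ?] [[|[|[|j]]] // ?].
Qed.

(** The origin is fixed by the rotation, which multiplies U_{m,n} by a nontrivial
    cube root of unity. *)
Lemma Uval0_col m n : ((m + 2 * n) %% 3 != 0)%N -> Uval m n 0 = 0.
Proof.
move=> mn; have := Ueval_rot m n (0 : C) 0 (zeta_cube R).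
rewrite !mulr0 -(expr_mod _ (zeta_cube R)) /Uval conjc0.
move=> U0; suff -> : Ueval m n (0 : C) 0 = 0 by rewrite rmorph0.
have : (zeta R ^+ ((m + 2 * n) %% 3) - 1) * Ueval m n (0 : C) 0 = 0.
  by rewrite mulrBl mul1r -U0 subrr.
move/eqP; rewrite mulf_eq0 subr_eq0 => /orP[|/eqP //].
have : ((m + 2 * n) %% 3 < 3)%N by rewrite ltn_mod.
have := zeta_neq1 R; have := zeta2_neq1 R.
by case: ((m + 2 * n) %% 3)%N mn => [|[|[|]]] // _ /negPf z2 /negPf z1; rewrite ?expr1 ?z1 ?z2.
Qed.

(** [None] stands for M_{0,0,0}, and [Some u] for the one-dimensional
    representation in which theta_u alone acts nontrivially. *)
Definition node_value (x : option 'I_3) (u : 'I_3) : K :=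
  qfact3 v *+ (Some u == x).

Definition node_label (x : option 'I_3) : rep_label R :=
  Label1 (node_value x 0) (node_value x 1) (node_value x 2).

Lemma rep1_exists (x : option 'I_3) : (x -> real_points e (0 : C)) ->
  exists phi : {lrmorphism T -> 'M[K]_(rep_dim (node_label x))}, is_rep phi /\
    forall m n u, phi (c_alg v e m n u) = (node_value x u * Uval m n 0)%:M.
Proof.
move=> V0.
have [||m n mn|u|u u' neq_u|m n u mn|phi [phiE phic]] := rep1_abstract (e := e)
  q2_neq0 (Uval00 0) (UvalX 0) (UvalY 0) (alpha := node_value x).
- exact: rmorph0.
- by rewrite conjc0 rmorph0.
- exact: Uval0_col.
- by rewrite /node_value; case: eqP => _; rewrite ?mulr1n // mulr0n !mulr0.
- rewrite /node_value; case: eqP => [<-|_]; last by rewrite mulr0n mul0r.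
  by rewrite [Some u' == _]eq_sym (inj_eq (@Some_inj _)) (negPf neq_u) mulr0n mulr0.
- rewrite /node_value; case: eqP => [xu|_]; last by rewrite mulr0n mul0r.
  by rewrite /Uval V0 ?rmorph0 ?mulr0 //; rewrite -xu.
exists phi; split=> // u; rewrite phiE.
by case: u => [[|[|[|u]]] // ltu] /=; congr (node_value _ _)%:M; apply: val_inj.
Qed.

Lemma ex_rotation : exists rot : 'I_3 -> 'I_t -> 'I_t,
  forall r k, z (rot r k) = zeta R ^+ r * z k.
Proof.
have rot1 r k : exists k', z k' = zeta R ^+ r * z k.
  have [|k' zk'] := @real_point_eigval R e (zeta R ^+ r * z k); last by exists k'.
  elim: r => [|r IH]; first by rewrite mul1r; apply: eigval_real_point.
  by rewrite exprS -mulrA; apply: real_points_zeta.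
exact: (fin_all_exists (fun r : 'I_3 => fin_all_exists (rot1 r))).
Qed.

Variable S : set C.
Hypothesis S_rep : orbit_representatives (@nonzero_real_points R e) S.

(** Three elements or none, according to whether the origin lies in V_e. *)
Definition nodes := {u : 'I_3 | `[< real_points e (0 : C) >]}.
Definition reps := {k : 'I_t | `[< S (z k) >]}.
Definition simples := option (nodes + reps)%type.

Definition simple_label (i : simples) : rep_label R :=
  match i with
  | None => node_label None
  | Some (inl u) => node_label (Some (val u))
  | Some (inr k) => Label3 (z (val k))
  end.

Lemma rep_free_index (rot : 'I_3 -> 'I_t -> 'I_t) :
  (forall r k, z (rot r k) = zeta R ^+ r * z k) ->
  forall r (i j : reps), rot r (val i) = val j -> i = j /\ r = 0.
Proof.
move=> rotE r i j rij; have Si : S (z (val i)) by apply/asboolP/(valP i).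
have Sj : S (z (val j)) by apply/asboolP/(valP j).
have [SV uniqS] := S_rep; have [_ z_neq0] := SV _ Si.
have zij : z (val j) = zeta R ^+ r * z (val i) by rewrite -rotE rij.
have [s [_ s_uniq]] := uniqS _ (SV _ Si).
have eq_z : z (val i) = z (val j).
  rewrite -(s_uniq (z (val i))); last by split=> //; exists 0%N; rewrite mul1r.
  by rewrite -(s_uniq (z (val j))) //; split=> //; exists r.
split; first exact/val_inj/(@eigval_inj R e).
have /eqP : (zeta R ^+ r - 1) * z (val i) = 0.
  by rewrite mulrBl mul1r -zij eq_z subrr.
rewrite mulf_eq0 subr_eq0 => /orP[|/eqP //].
by case: r {rij zij} => [[|[|[|r]]] // ltr]; rewrite ?expr1 ?(negPf (zeta_neq1 R))
  ?(negPf (zeta2_neq1 R)) // => _; apply: val_inj.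
Qed.

Lemma cover_index (rot : 'I_3 -> 'I_t -> 'I_t) :
  (forall r k, z (rot r k) = zeta R ^+ r * z k) ->
  forall k, z k == 0 \/ exists r (j : reps), k = rot r (val j).
Proof.
move=> rotE k; have [zk0|/eqP zk0] := eqVneq (z k) 0; [by left|right].
have [SV uniqS] := S_rep.
have [s [[Ss [n sE]] _]] := uniqS (z k) (conj (@eigval_real_point R e k) zk0).
have [j zj] := real_point_eigval (SV _ Ss).1.
have Sj : `[< S (z j) >] by apply/asboolP; rewrite -zj.
have lt3 m : (m %% 3 < 3)%N by rewrite ltn_mod.
exists (Ordinal (lt3 (2 * n)%N)), (exist _ j Sj) => /=.
apply: (@eigval_inj R e); rewrite rotE /= -zj sE (expr_mod _ (zeta_cube R)) mulrA -exprD.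
have -> : (2 * n + n = 3 * n)%N by lia.
by rewrite exprM zeta_cube expr1n mul1r.
Qed.

Lemma Uval_rot (rot : 'I_3 -> 'I_t -> 'I_t) :
  (forall r k, z (rot r k) = zeta R ^+ r * z k) ->
  forall r k (i : 'I_t), Uval (weight i).1 (weight i).2 (z (rot r k)) =
    cst (zeta R) ^+ (r * colour i) * Uval (weight i).1 (weight i).2 (z k).
Proof.
move=> rotE r k i; rewrite /Uval rotE.
have -> : conjc (zeta R ^+ r * z k) = (zeta R ^+ r) ^+ 2 * conjc (z k).
  rewrite -exprM mulnC exprM -zeta_conj.
  by apply: etrans (rmorphM conjc _ _) _; congr (_ * _); apply: rmorphXn.
rewrite Ueval_rot ?rmorphM /=; last first.
  by rewrite -exprM mulnC exprM zeta_cube expr1n.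
by congr (_ * _); rewrite -exprM; apply: rmorphXn.
Qed.

End Classification.

Section Completeness.
Variables (R : realType) (e : nat).
Local Notation C := R[i].
Local Notation K := {fraction {poly C}}.
Local Notation v := (vpar R).
Local Notation T := (T_alg v e).
Local Notation t := (size (alcove e)).
Local Notation z k := (@eigval R e k).

Lemma cst_zeta_sum : 1 + cst (zeta R) + cst (zeta R) ^+ 2 = 0 :> K.
Proof.
have := congr1 (@cst R) (zeta_sum R).
by rewrite !rmorphD rmorph1 rmorphXn rmorph0.
Qed.

Lemma three_neq0 : 3%:R != 0 :> K.
Proof.
have -> : 3%:R = cst (3%:R : C) :> K by rewrite rmorph_nat.
by rewrite fmorph_eq0 pnatr_eq0.
Qed.

Lemma Uval_unit :
  (\matrix_(i, k) Uval (weight i).1 (weight i).2 (z k) : 'M[K]_t) \in unitmx.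
Proof.
have -> : (\matrix_(i, k) Uval (weight i).1 (weight i).2 (z k) : 'M[K]_t)
    = map_mx (@cst R) (Ueval_mx R e) by apply/matrixP => i k; rewrite !mxE.
by rewrite map_unitmx Ueval_mx_unit.
Qed.

Variable S : set C.
Hypothesis S_rep : orbit_representatives (@nonzero_real_points R e) S.

Local Notation simples := (simples e S).
Local Notation label := (@simple_label R e S).

Lemma ex_matrix_units :
  exists (phi : forall i : simples, {lrmorphism T -> 'M[K]_(rep_dim (label i))})
    (E : forall i : simples, 'I_(rep_dim (label i)) -> 'I_(rep_dim (label i)) -> T),
  [/\ forall i, is_rep (phi i),
      forall i a b, phi i (E i a b) = delta_mx a b,
      forall i j a b, i != j -> phi j (E i a b) = 0 &
      forall s, (forall i, phi i s = 0) -> s = 0].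
Proof.
have [rot rotE] := ex_rotation R e.
have [//|phi0 [phi0_rep phi0c]] := @rep1_exists R e None.
have /choice[phi1 phi1P] (u : nodes R e) : exists phi : {lrmorphism T -> 'M[K]_1},
    is_rep (i := node_label R (Some (val u))) phi /\ forall m n x,
      phi (c_alg v e m n x) = (node_value R (Some (val u)) x * Uval m n 0)%:M.
  by apply: rep1_exists => _; apply/asboolP/(valP u).
have /choice[phi3 phi3P] (k : reps e S) : exists phi : {lrmorphism T -> 'M[K]_3},
    is_rep (i := Label3 (z (val k))) phi /\ forall m n x,
      phi (c_alg v e m n x) = (qint v 2 * Uval m n (z (val k))) *:
        (delta_mx (x + (m + 2 * n)%:R) x *m rowmx (z (val k))).
  exact/rep3_exists/eigval_real_point.
pose W (k i : 'I_t) : K := Uval (weight i).1 (weight i).2 (z k).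
pose zero : pred 'I_t := fun k => z k == 0.
have rot0 k : rot 0 k = k by apply: (@eigval_inj R e); rewrite rotE mul1r.
have zero_fixed r k : zero k -> rot r k = k.
  by move=> /eqP k0; apply: (@eigval_inj R e); rewrite rotE k0 mulr0.
have zero_rot r k : zero (rot r k) -> zero k.
  by rewrite /zero rotE mulf_eq0 expf_eq0 (negPf (zeta_neq0 R)) andbF.
have zero_node k x : zero k -> exists u : nodes R e, val u = x.
  move=> /eqP k0; have V0 : `[< real_points e (0 : C) >].
    by apply/asboolP; rewrite -k0; apply: eigval_real_point.
  by exists (exist _ x V0).
have node_zero (u : nodes R e) : exists k, zero k.
  have /asboolP/real_point_eigval[k k0] := valP u.
  by exists k; rewrite /zero -k0.
have rep_nonzero (j : reps e S) : ~~ zero (val j).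
  have /asboolP/(S_rep.1)[_ zj0] := valP j; exact/eqP.
have phi0E (i : 'I_t) x : phi0 (c_alg v e (weight i).1 (weight i).2 x) = 0.
  by rewrite phi0c /node_value mulr0n mul0r raddf0.
have phi1E u k (i : 'I_t) x : zero k -> phi1 u (c_alg v e (weight i).1 (weight i).2 x) =
    (qfact3 v * W k i *+ (x == val u))%:M.
  move=> /eqP k0; have [_ ->] := phi1P u.
  by rewrite /node_value (inj_eq (@Some_inj _)) mulrnAl /W k0.
have phi3E j (i : 'I_t) x : phi3 j (c_alg v e (weight i).1 (weight i).2 x) =
    (qint v 2 * W (val j) i) *: (delta_mx (x + (colour i)%:R) x *m rowmx (z (val j))).
  by have [_ ->] := phi3P j.
have P_unit (j : reps e S) : rowmx (z (val j)) \in unitmx by apply: rowmx_unit.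
have W_rot := Uval_rot rotE; have cover := cover_index S_rep rotE.
have rep_free := rep_free_index S_rep rotE.
have q2 := q2_neq0 R; have q3 := qfact3_neq0 R.
pose phi (i : simples) : {lrmorphism T -> 'M[K]_(rep_dim (label i))} :=
  match i return {lrmorphism T -> 'M[K]_(rep_dim (label i))} with
  | None => phi0 | Some (inl u) => phi1 u | Some (inr k) => phi3 k end.
have units i a b : exists x, phi i x = delta_mx a b /\
    forall j, i != j -> phi j x = 0.
  case: i a b => [[u|j]|] /= a b.
  - have [x [x0 x1 x1' x3]] := node_unit q3 cst_zeta_sum three_neq0 Uval_unit W_rot
      zero_fixed zero_rot val_inj node_zero rep_nonzero phi0E phi1E phi3E u.
    exists x; split=> [|[[u'|j]|] //= neq].
      by rewrite x1; apply/matrixP => i j; rewrite !ord1 !mxE eqxx.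
    by apply: x1'; rewrite eq_sym; apply: contraNneq neq => ->.
  - have [x [x0 x1 x3 x3']] := orbit_unit q2 cst_zeta_sum three_neq0 Uval_unit W_rot
      rot0 zero_fixed node_zero rep_free rep_nonzero P_unit phi0E phi1E phi3E j a b.
    exists x; split=> [//|[[u'|j']|] //= neq].
    by apply: x3'; rewrite eq_sym; apply: contraNneq neq => ->.
  - have [x [x0 x1 x3]] := trivial_unit q2 q3 cst_zeta_sum three_neq0 Uval_unit W_rot
      rot0 zero_fixed zero_rot val_inj node_zero rep_free rep_nonzero P_unit
      phi0E phi1E phi3E.
    exists x; split=> [|[[u'|j']|] //= neq].
    by rewrite x0; apply/matrixP => i j; rewrite !ord1 !mxE eqxx.
exists phi, (fun i a b => sval (cid (units i a b))); split.
- by case=> [[u|k]|]; [have [] := phi1P u|have [] := phi3P k|].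
- by move=> i a b; case: cid => x [].
- by move=> i j a b neq; case: cid => x /= [_]; apply.
- move=> s s0; apply: (joint_injective q2 q3 cst_zeta_sum Uval_unit W_rot
    zero_node cover P_unit phi0E phi1E phi3E) => [|u|j].
  + exact: (s0 None).
  + exact: (s0 (Some (inl u))).
  + exact: (s0 (Some (inr j))).
Qed.

Lemma rep_dim_gt0 (i : rep_label R) : (0 < rep_dim i)%N.
Proof. by case: i. Qed.

Lemma is_rep_unique (i : rep_label R)
    (phi psi : {lrmorphism T -> 'M[K]_(rep_dim i)}) :
  is_rep phi -> is_rep psi -> phi =1 psi.
Proof. by move=> phiE psiE; apply: T_alg_morph_unique => u; rewrite phiE psiE. Qed.

Theorem simple_classification :
  semisimple_ring T /\
  complete_irredundant_list e [set i | exists k : simples, i = label k].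
Proof.
have [phi [E [phi_rep phiE phiE_neq phi_inj]]] := ex_matrix_units.
split; first exact: unitE_semisimple phiE phiE_neq phi_inj.
split=> [_ [k ->]|i j f g [k ik] [l jl]|W W_simple].
- exists (phi k); first exact: phi_rep.
  exact: (matrix_module_simple phiE) (rep_dim_gt0 _).
- subst i j => f_rep g_rep fg; congr label.
  apply: (matrix_module_iso_inj phiE phiE_neq _ _ _ fg).
  + exact: rep_dim_gt0.
  + exact: is_rep_unique.
  + exact: is_rep_unique.
- have [k [b [w Ew]]] := simple_acts_nontrivially phiE phiE_neq phi_inj W_simple.
  exists (label k), (phi k); split; [by exists k|exact: phi_rep|].
  exact: (simple_is_matrix_module phiE phiE_neq phi_inj _ W_simple Ew).
Qed.

End Completeness.

(** * The classification theorem *)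

Section Labels.
Variables (R : realType) (e : nat) (S : set R[i]).
Hypothesis S_rep : orbit_representatives (@nonzero_real_points R e) S.
Local Notation q := (qfact3 (vpar R)).

Lemma Label3_simples : [set Label3 z | z in S] =
  [set i | exists k : reps e S, i = Label3 (eigval R (val k))].
Proof.
apply/seteqP; split=> [_ [x Sx <-]|_ [k ->]]; last first.
  by exists (eigval R (val k)) => //; apply/asboolP/(valP k).
have [j xj] := real_point_eigval (S_rep.1 _ Sx).1.
have Sj : `[< S (eigval R j) >] by apply/asboolP; rewrite -xj.
by exists (exist _ j Sj); rewrite xj.
Qed.

Lemma simple_labels : [set i | exists k : simples e S, i = simple_label k] =
  [set node_label R None] `|` [set i | exists u : nodes R e, i = node_label R (Some (val u))]
    `|` [set Label3 z | z in S].
Proof.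
rewrite Label3_simples; apply/seteqP; split=> [_ [[[u|k]|] ->]|i].
- by left; right; exists u.
- by right; exists k.
- by left; left.
case=> [[->|[u ->]]|[k ->]].
- by exists None.
- by exists (Some (inl u)).
- by exists (Some (inr k)).
Qed.

Lemma node_label0 : node_label R None = Label1 0 0 0.
Proof. by rewrite /node_label /node_value !mulr0n. Qed.

Lemma node_labels_mod3 : (e %% 3 = 0)%N ->
  [set i | exists u : nodes R e, i = node_label R (Some (val u))] =
  [set Label1 q 0 0; Label1 0 q 0; Label1 0 0 q].
Proof.
move=> e0; have V0 : `[< real_points e (0 : R[i]) >] by apply/asboolP/real_points0.
apply/seteqP; split=> [_ [[u Vu] ->] /=|i].
  by case: u Vu => [[|[|[|u]]] // ?] _; rewrite /node_label /node_value /= ?mulr0n ?mulr1n;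
    [left; left|left; right|right].
pose n := fun x : 'I_3 => exist _ x V0 : nodes R e.
by case=> [[->|->]|->]; [exists (n 0)|exists (n 1)|exists (n 2%:R)];
  rewrite /node_label /node_value /= ?mulr0n ?mulr1n.
Qed.

Lemma node_labels_neq : (e %% 3 <> 0)%N ->
  [set i | exists u : nodes R e, i = node_label R (Some (val u))] = set0.
Proof.
move=> e0; apply/seteqP; split=> // _ [[u /asboolP/real_points0]] //.
Qed.

End Labels.

Theorem theorem3p21 (R : realType) (e : nat) :
  semisimple_ring (T_alg (vpar R) e)
  /\ ((e %% 3 = 0)%N ->
        (forall S : set R[i],
           orbit_representatives (nonzero_real_points e) S ->
           complete_irredundant_list e
             ([set Label1 0 0 0;
                   Label1 (qfact3 (vpar R)) 0 0;
                   Label1 0 (qfact3 (vpar R)) 0;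
                   Label1 0 0 (qfact3 (vpar R))]
              `|` [set Label3 z | z in S]))
        /\ (exists n : nat, (3 * n = t_num e - 1)%N /\
              has_orbits (@nonzero_real_points R e) n))
  /\ ((e %% 3 <> 0)%N ->
        (forall S : set R[i],
           orbit_representatives (real_points e) S ->
           complete_irredundant_list e
             (Label1 0 0 0 |` [set Label3 z | z in S]))
        /\ (exists n : nat, (3 * n = t_num e)%N /\
              has_orbits (@real_points R e) n)).
Proof.
split.
  have [S S_rep] := ex_representatives R e.
  by have [] := simple_classification S_rep.
split=> e3; split.
- move=> S S_rep; have [_] := simple_classification S_rep.
  by rewrite simple_labels // node_labels_mod3 // node_label0 !setUA.
- exists (size (cubes R e)); split; last exact: nonzero_has_orbits.
  by rewrite three_cubes e3.
- rewrite -(real_points_nonzero R e3) => S S_rep.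
  have [_] := simple_classification S_rep.
  by rewrite simple_labels // node_labels_neq // node_label0 setU0.
- exists (size (cubes R e)); split.
    by rewrite three_cubes; case: eqP => //; rewrite subn0.
  by rewrite -(real_points_nonzero R e3); apply: nonzero_has_orbits.
Qed.
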